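(* Let $S$ be a finite set of nonzero integers, and for $n\ge0$ let $a_S(n)$ be the number of sequences $(s_1,\dots,s_n)\in S^n$ such that $s_1+\dots+s_n=0$ and every partial sum $s_1+\dots+s_j$ ($1\le j\le n$) is $\le 0$. Then $a_S(n)$ is P-recursive: there exist a positive integer $L$ and polynomials $p_0(n),\dots,p_L(n)$, not all zero, such that $\sum_{i=0}^{L}p_i(n)\,a_S(n-i)=0$ for all $n\ge L$. Furthermore, there exists an algorithm for finding such a linear recurrence. *)

(* Defs.v *)
From HB Require Import structures.
From mathcomp Require Import all_boot all_order all_algebra finmap.

Set Implicit Arguments.
Unset Strict Implicit.
Unset Printing Implicit Defensive.

Import Order.TTheory GRing.Theory Num.Theory.
Local Open Scope ring_scope.

Definition walk_count (S : {fset int}) (n : nat) : nat :=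
  #|[set w : n.-tuple S |
      (\sum_(i < n) val (tnth w i) == 0)
      && [forall j : 'I_n, \sum_(i < n | (i <= j)%N) val (tnth w i) <= 0]]|.

Definition is_P_recurrence (a : nat -> nat) (L : nat)
    (p : L.+1.-tuple {poly rat}) : Prop :=
  [/\ (0 < L)%N,
      exists i : 'I_L.+1, tnth p i != 0
    & forall n : nat, (L <= n)%N ->
        \sum_(i < L.+1) (tnth p i).[n%:R] * (a (n - i)%N)%:R = 0].

Definition P_recursive (a : nat -> nat) : Prop :=
  exists (L : nat) (p : L.+1.-tuple {poly rat}), is_P_recurrence a p.

(* Kleene's partial recursive functions, the model of computation used to make
   "there exists an algorithm" precise; [recfun n] is the syntax of the n-ary
   ones. *)
Inductive recfun : nat -> Type :=
| RZero : recfun 0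
| RSucc : recfun 1
| RProj (n : nat) (i : 'I_n) : recfun n
| RComp (m n : nat) (f : recfun m) (g : 'I_m -> recfun n) : recfun n
| RPrim (n : nat) (f : recfun n) (g : recfun n.+2) : recfun n.+1
| RMu (n : nat) (f : recfun n.+1) : recfun n.

(* [computes f v y]: the evaluation of f on the arguments v terminates, with
   value y. The recursion variable of RPrim and the search variable of RMu come
   first; in RPrim, h lists the successive values of the recursion. *)
Fixpoint computes (n : nat) (f : recfun n) : n.-tuple nat -> nat -> Prop :=
  match f in recfun n return n.-tuple nat -> nat -> Prop with
  | RZero => fun _ y => y = 0%N
  | RSucc => fun v y => y = (thead v).+1
  | RProj _ i => fun v y => y = tnth v i
  | RComp m _ f g => fun v y =>
      exists w : m.-tuple nat,
        (forall i : 'I_m, computes (g i) v (tnth w i)) /\ computes f w y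
  | RPrim _ f g => fun v y =>
      exists h : nat -> nat,
        [/\ computes f [tuple of behead v] (h 0%N),
            forall k : nat, (k < thead v)%N ->
              computes g [tuple of k :: h k :: behead v] (h k.+1)
          & y = h (thead v)]
  | RMu _ f => fun v y =>
      computes f [tuple of y :: v] 0%N /\
      forall k : nat, (k < y)%N ->
        exists z : nat, computes f [tuple of k :: v] z.+1
  end.

Lemma computes_functional (n : nat) (f : recfun n) (v : n.-tuple nat)
    (y z : nat) :
  computes f v y -> computes f v z -> y = z.
Proof.
elim: f v y z => {n} /= [||n i|m n f IHf g IHg|n f IHf g IHg|n f IHf] v y z.
- by move=> -> ->.
- by move=> -> ->.
- by move=> -> ->.
- case=> w [gw fw] [w' [gw' fw']].
  have eq_w : w = w' by apply: eq_from_tnth => i; apply: IHg (gw i) (gw' i).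
  by rewrite -eq_w in fw'; apply: IHf fw fw'.
- case=> h [h0 hS ->] [h' [h'0 h'S ->]].
  suff eq_h k : (k <= thead v)%N -> h k = h' k by apply: eq_h.
  elim: k => [_|k IHk lt_kv]; first exact: IHf h0 h'0.
  have := h'S k lt_kv; rewrite -(IHk (ltnW lt_kv)).
  exact: IHg (hS k lt_kv).
- case=> fy lt_y [fz lt_z]; case: (ltngtP y z) => // [/lt_z|/lt_y] [x fx].
    by have := IHf _ _ _ fy fx.
  by have := IHf _ _ _ fz fx.
Qed.

(* Effective encodings by natural numbers, built on the bijection
   [CodeSeq.code : seq nat -> nat]. *)
Definition code_int (z : int) : nat :=
  match z with Posz n => n.*2 | Negz n => n.*2.+1 end.

Definition code_ints (s : seq int) : nat := CodeSeq.code (map code_int s).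

Definition code_rat (q : rat) : nat :=
  CodeSeq.code [:: code_int (numq q); code_int (denq q)].

(* A polynomial is a list of coefficients, constant term first. *)
Definition code_poly (p : {poly rat}) : nat := CodeSeq.code (map code_rat p).

Definition code_polys (s : seq {poly rat}) : nat :=
  CodeSeq.code (map code_poly s).

(* Main.v *)
(* Let [d] be the largest downward step, [t = tau ^ d] and
   [Q z = \sum_(x in S) z ^ (d + x)].  By the kernel method, [t * A(t)], where
   [A] is the generating function of the walks, is up to sign the product of
   the [d] roots [z_k] of [z ^ d = t Q z] that are power series in [tau].  The
   monomials in the [z_k] span a finite-dimensional space over Q(t) that is
   closed under products and, up to a denominator [delta], under
   [theta = t d/dt]; hence [A], [theta A], [theta^2 A], ... are linearly
   dependent over Q(t), and a linear differential equation for [A] is a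
   recurrence for its coefficients.

   All degrees in this argument are bounded explicitly.  A nonzero element [h]
   of the space divides a nonzero polynomial in [t] of bounded degree, namely
   the lowest nonzero coefficient of a linear relation between its powers, so
   its order of vanishing is bounded too.  Therefore a candidate recurrence that
   holds for the first [N] indices, with [N] computable, holds for all of
   them, and an unbounded search for a candidate passing this test is an
   algorithm. *)

Require Import Defs.
From HB Require Import structures.
From mathcomp Require Import all_boot all_order all_algebra finmap.
From mathcomp Require Import algC cyclotomic ring zify boolp.

Set Implicit Arguments.
Unset Strict Implicit.
Unset Printing Implicit Defensive.

Import Order.TTheory GRing.Theory Num.Theory.
Local Open Scope ring_scope.

(** * Formal power series *)

(** Only the bounds have to be computable: roots, relations and inverses may come from choice and
    from algebraic numbers, since the search never sees them. The bounds require control of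
    denominators. Each root satisfies a relation of degree [m] whose leading coefficient can be
    arranged to be exactly [t], so reducing a product of monomials costs only powers of [t]. This is
    why coefficients are Laurent polynomials, one number [e] bounding both pole and degree. Here
    [0 \notin S] matters: if zero were the largest step, the leading coefficient would be [1 - t].
    The other denominator, [delta], enters only through differentiation. The operator [t d/dt] does
    not raise the degree of a polynomial in [t] and turns [a n] into [n * a n]. Independence of the
    monomials is never claimed: dependences come from counting rows of coefficients. A recurrence is
    demanded only for [n >= L], so the zero test applies to [\sum_j w j * theta^j A - w0], the
    polynomial [w0] holding the first [L] coefficients. *)

Record fps (R : Type) := Fps { fcoef :> nat -> R }.

HB.instance Definition _ (R : Type) := gen_eqMixin (fps R).
HB.instance Definition _ (R : Type) := gen_choiceMixin (fps R).

Lemma fpsP (R : Type) (f g : fps R) : f =1 g <-> f = g.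
Proof.
split=> [|-> //]; case: f g => [f] [g] /= fg.
by congr Fps; apply/funext.
Qed.

Section FpsRing.
Variable R : fieldType.
Implicit Types f g h : fps R.

Definition fps_zero : fps R := Fps (fun _ => 0).
Definition fps_opp f : fps R := Fps (fun n => - f n).
Definition fps_add f g : fps R := Fps (fun n => f n + g n).

Fact fps_addA : associative fps_add.
Proof. by move=> f g h; apply/fpsP => n; apply: addrA. Qed.
Fact fps_addC : commutative fps_add.
Proof. by move=> f g; apply/fpsP => n; apply: addrC. Qed.
Fact fps_add0 : left_id fps_zero fps_add.
Proof. by move=> f; apply/fpsP => n; apply: add0r. Qed.
Fact fps_addN : left_inverse fps_zero fps_opp fps_add.
Proof. by move=> f; apply/fpsP => n; apply: addNr. Qed.

HB.instance Definition _ :=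
  GRing.isZmodule.Build (fps R) fps_addA fps_addC fps_add0 fps_addN.

Lemma fcoefD f g n : (f + g) n = f n + g n. Proof. by []. Qed.
Lemma fcoefB f g n : (f - g) n = f n - g n. Proof. by []. Qed.

Lemma fcoef_sum (I : Type) (r : seq I) (P : pred I) (F : I -> fps R) n :
  (\sum_(i <- r | P i) F i) n = \sum_(i <- r | P i) F i n.
Proof. by elim/big_rec2: _ => // i x y _ <-. Qed.

Definition fps_mul f g : fps R :=
  Fps (fun n => \sum_(i < n.+1) f i * g (n - i)%N).
Definition fps_const (c : R) : fps R := Fps (fun n => c *+ (n == 0)).

Definition fps_trunc N f : {poly R} := \poly_(i < N) f i.

(** Each coefficient of a product of series is one of a product of polynomials, so commutativity and
    associativity are inherited from [{poly R}]. *)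
Lemma fps_trunc_mul N f g n : (n < N)%N ->
  fps_mul f g n = (fps_trunc N f * fps_trunc N g)`_n.
Proof.
move=> ltnN; rewrite coefM; apply: eq_bigr => i _; rewrite !coef_poly.
by rewrite (leq_ltn_trans (leq_ord i) ltnN) (leq_ltn_trans (leq_subr _ _) ltnN).
Qed.

Fact fps_mulC : commutative fps_mul.
Proof.
by move=> f g; apply/fpsP => n; rewrite !(@fps_trunc_mul n.+1) // mulrC.
Qed.

Fact fps_mulA : associative fps_mul.
Proof.
move=> f g h; apply/fpsP => n; pose T := fps_trunc n.+1.
have TE (u : fps R) (i : 'I_n.+1) : u i = (T u)`_i by rewrite coef_poly ltn_ord.
have TB (u : fps R) (i : 'I_n.+1) : u (n - i)%N = (T u)`_(n - i)%N.
  by rewrite coef_poly ltnS leq_subr.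
transitivity ((T f * (T g * T h))`_n).
  rewrite coefM; apply: eq_bigr => i _; rewrite -TE; congr (_ * _).
  by apply: fps_trunc_mul; rewrite ltnS leq_subr.
rewrite mulrA coefM; apply: eq_bigr => i _; rewrite -TB; congr (_ * _).
by symmetry; apply: fps_trunc_mul.
Qed.

Fact fps_mul1 : left_id (fps_const 1) fps_mul.
Proof.
move=> f; apply/fpsP => n /=; rewrite big_ord_recl big1 => [|i _].
  by rewrite addr0 mul1r subn0.
by rewrite /= mul0r.
Qed.

Fact fps_mulDl : left_distributive fps_mul +%R.
Proof.
move=> f g h; apply/fpsP => n; rewrite fcoefD -big_split.
by apply: eq_bigr => i _; rewrite mulrDl.
Qed.

Fact fps_one_neq0 : fps_const 1 != 0 :> fps R.
Proof. by apply/eqP => /fpsP/(_ 0)/= /eqP; rewrite oner_eq0. Qed.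

HB.instance Definition _ := GRing.Zmodule_isComNzRing.Build (fps R)
  fps_mulA fps_mulC fps_mul1 fps_mulDl fps_one_neq0.

Lemma fcoefM f g n : (f * g) n = \sum_(i < n.+1) f i * g (n - i)%N.
Proof. by []. Qed.

(** An integral domain carries a unit structure; here invertibility is decided classically and an
    inverse picked by choice. *)
Definition fps_unit : pred (fps R) := fun f => `[< exists g, g * f = 1 >].
Definition fps_inv f : fps R :=
  if pselect (exists g, g * f = 1) is left h then projT1 (cid h) else f.

Fact fps_mulV : {in fps_unit, left_inverse 1 fps_inv *%R}.
Proof.
move=> f /asboolP uf; rewrite /fps_inv; case: pselect => // h.
by case: cid.
Qed.
Fact fps_unitPl f g : g * f = 1 -> fps_unit f.
Proof. by move=> gf; apply/asboolP; exists g. Qed.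
Fact fps_inv_out : {in [predC fps_unit], fps_inv =1 id}.
Proof.
move=> f; rewrite inE /= => /negP nuf; rewrite /fps_inv.
by case: pselect => // h; case: nuf; apply/asboolP.
Qed.

HB.instance Definition _ := GRing.ComNzRing_hasMulInverse.Build (fps R)
  fps_mulV fps_unitPl fps_inv_out.

Lemma fps_order f : f != 0 ->
  exists2 n, f n != 0 & forall i, (i < n)%N -> f i = 0.
Proof.
move=> nzf; have exn : exists n, f n != 0.
  apply: contrapT => noex; case/eqP: nzf; apply/fpsP => n.
  by apply: contrapT => /eqP fn; apply: noex; exists n.
case: (ex_minnP exn) => n nz min_n; exists n => // i ltin.
by apply: contraTeq ltin => /min_n; rewrite -leqNgt.
Qed.

Fact fps_integral : GRing.integral_domain_axiom (fps R).
Proof.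
move=> f g fg0; case: (eqVneq f 0) => //= /fps_order [m nzm ltm].
case: (eqVneq g 0) => //= /fps_order [n nzn ltn].
move/fpsP: fg0 => /(_ (m + n)%N); rewrite fcoefM.
have ltm_mn : (m < (m + n).+1)%N by rewrite ltnS leq_addr.
rewrite (bigD1 (Ordinal ltm_mn)) //= big1 => [|i /eqP neq_im].
  by rewrite addr0 addKn; move/eqP: (mulf_neq0 nzm nzn).
case: (ltngtP i m) => [/ltm ->|lt_mi|eq_im]; first by rewrite mul0r.
  by rewrite (ltn (m + n - i)%N) ?mulr0 //; move: (ltn_ord i); lia.
by case: neq_im; apply: val_inj.
Qed.

HB.instance Definition _ :=
  GRing.ComUnitRing_isIntegral.Build (fps R) fps_integral.

Fact fps_const_zmod : zmod_morphism fps_const.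
Proof. by move=> a b; apply/fpsP => n; rewrite /= mulrnBl. Qed.
Fact fps_const_monoid : monoid_morphism fps_const.
Proof.
split=> // a b; apply/fpsP => n; rewrite fcoefM big_ord_recl big1 => [|i _].
  by rewrite /= mulr1n addr0 subn0 mulrnAr.
by rewrite /= mul0r.
Qed.
HB.instance Definition _ :=
  GRing.isZmodMorphism.Build R (fps R) fps_const fps_const_zmod.
HB.instance Definition _ :=
  GRing.isMonoidMorphism.Build R (fps R) fps_const fps_const_monoid.

Lemma fcoefCM c f n : (fps_const c * f) n = c * f n.
Proof.
rewrite fcoefM big_ord_recl big1 => [|i _]; first by rewrite /= addr0 subn0.
by rewrite /= mul0r.
Qed.

Definition fps_X : fps R := Fps (fun n => (n == 1)%:R).

Lemma fcoefXM f n : (fps_X * f) n = if n is n'.+1 then f n' else 0.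
Proof.
rewrite fcoefM; case: n => [|n]; first by rewrite big_ord1 mul0r.
rewrite big_ord_recl mul0r add0r big_ord_recl big1 => [|i _].
  by rewrite mul1r addr0 subSS subn0.
by rewrite mul0r.
Qed.

Lemma fcoefXnM k f n :
  (fps_X ^+ k * f) n = if (k <= n)%N then f (n - k)%N else 0.
Proof.
elim: k n => [|k IHk] n; first by rewrite mul1r subn0.
by rewrite exprS -mulrA fcoefXM; case: n => [|n] //; rewrite IHk.
Qed.

(** Congruence modulo [X ^ n], the notion of approximation in which limits of series are taken. *)
Definition fps_eqm n f g := forall i, (i < n)%N -> f i = g i.

Lemma fps_eqmM n f f' g g' :
  fps_eqm n f f' -> fps_eqm n g g' -> fps_eqm n (f * g) (f' * g').
Proof.
move=> ff gg i ltin; rewrite !fcoefM; apply: eq_bigr => j _.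
by rewrite ff ?gg //; move: (ltn_ord j); lia.
Qed.

Lemma fps_eqmX n f g k : fps_eqm n f g -> fps_eqm n (f ^+ k) (g ^+ k).
Proof.
move=> fg; elim: k => [|k IHk]; first by move=> i.
by rewrite !exprS; apply: fps_eqmM.
Qed.

Lemma fps_eqmXM n f g : fps_eqm n f g -> fps_eqm n.+1 (fps_X * f) (fps_X * g).
Proof. by move=> fg [|i] ltin; rewrite !fcoefXM //; apply: fg. Qed.

Lemma fps_eqm_all f g : (forall n, fps_eqm n f g) -> f = g.
Proof. by move=> fg; apply/fpsP => n; apply: (fg n.+1). Qed.

(** A fixed point theorem on the ball of series that share the constant coefficient of [f0]: [Phi]
    gains one correct coefficient per iteration. *)
Lemma fps_contraction (f0 : fps R) (Phi : fps R -> fps R) :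
  fps_eqm 1 (Phi f0) f0 ->
  (forall n f g, (0 < n)%N -> fps_eqm 1 f f0 -> fps_eqm 1 g f0 ->
     fps_eqm n f g -> fps_eqm n.+1 (Phi f) (Phi g)) ->
  exists2 f, Phi f = f & fps_eqm 1 f f0.
Proof.
move=> Phi0 ctr; pose u n := iter n Phi f0.
have u0 n : fps_eqm 1 (u n) f0.
  elim: n => [|n IHn] i lti //; rewrite -(Phi0 i lti).
  by apply: (ctr 1) => //; lia.
have uS n : fps_eqm n.+1 (u n) (u n.+1).
  elim: n => [|n IHn]; first by move=> i lti; rewrite (u0 1).
  exact: (ctr n.+1 (u n) (u n.+1)).
have u_le n m i : (i <= n)%N -> (n <= m)%N -> u m i = u n i.
  move=> lein /subnK <-; elim: (m - n)%N => [|k IHk] //.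
  by rewrite -IHk addSn -uS //; lia.
(* The coefficient of index [n] is stationary from the [n]-th iterate on, so the diagonal is the
   limit. *)
pose f := Fps (fun n => u n n).
have fu n : fps_eqm n.+1 f (u n) by move=> i lti; rewrite /= -(u_le i n).
have f_f0 : fps_eqm 1 f f0 by move=> i lti; rewrite (fu 0%N).
exists f => //; apply: fps_eqm_all => -[|n] i lti //.
rewrite (fu n) // (uS n) //; by apply: (ctr n.+1) => //; lia.
Qed.

End FpsRing.

(** * Modules filtered by degree *)

(** Linear algebra over [rat] rather than over the fraction field keeps degrees explicit. With [D]
    coefficients for each [q j] there are [(M + 1) * D] unknowns and [M * (D + b)] equations;
    [D = b * M + 1] leaves exactly one unknown more than equations. *)
Lemma poly_rows_dependent (I : finType) (b : nat)
    (r : 'I_(#|I|).+1 -> I -> {poly rat}) :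
  (forall j i, (size (r j i) <= b)%N) ->
  exists q : 'I_(#|I|).+1 -> {poly rat},
    [/\ exists j, q j != 0, forall j, (size (q j) <= b * #|I| + 1)%N
      & forall i, \sum_j q j * r j i = 0].
Proof.
move=> szr; set M := #|I|; set D := (b * M + 1)%N.
pose f (X : 'M[rat]_(M.+1, D)) : 'M[rat]_(M, (D + b)%N) :=
  \matrix_i poly_rV (\sum_j rVpoly (row j X) * r j (enum_val i)).
have f_lin : linear f.
  move=> a X Y; apply/row_matrixP => i; rewrite linearP /= !rowK -linearP /=.
  congr poly_rV; rewrite scaler_sumr -big_split /=; apply: eq_bigr => j _.
  by rewrite !linearP /= mulrDl -scalerAl.
pose fL := HB.pack_for {linear 'M[rat]_(M.+1, D) -> 'M[rat]_(M, (D + b)%N)} f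
  (GRing.isLinear.Build _ _ _ _ f f_lin).
have : kermx (lin_mx fL) != 0.
  rewrite kermx_eq0 /row_free neq_ltn.
  by rewrite (leq_ltn_trans (rank_leq_col _)) //; rewrite /D; nia.
case/rowV0Pn => u /sub_kermxP uf0 nzu.
pose X : 'M[rat]_(M.+1, D) := vec_mx u.
have fX0 : f X = 0.
  apply: (can_inj mxvecK); rewrite linear0.
  by rewrite -uf0 -[u]vec_mxK mul_vec_lin.
exists (fun j => rVpoly (row j X)); split.
- have /rowV0Pn [_ /submxP[w ->] nzw] : X != 0.
    by apply: contraNneq nzu => /(congr1 mxvec); rewrite vec_mxK linear0 => ->.
  apply: contrapT => noex; case/eqP: nzw.
  suff -> : X = 0 by rewrite mulmx0.
  apply/row_matrixP => j; rewrite row0 -[row j X]rVpolyK.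
  suff -> : rVpoly (row j X) = 0 by rewrite linear0.
  by apply: contrapT => /eqP nz; apply: noex; exists j.
- by move=> j; apply: size_poly.
- move=> i; move: fX0 => /row_matrixP/(_ (enum_rank i)).
  rewrite rowK enum_rankK row0 => /(congr1 (@rVpoly _ _)).
  rewrite linear0 poly_rV_K //.
  apply: (leq_trans (size_sum _ _ _)); apply/bigmax_leqP => j _.
  apply: leq_trans (size_polyMleq _ _) _.
  have szX : (size (rVpoly (row j X)) <= D)%N by apply: size_poly.
  by rewrite (leq_trans (leq_pred _)) // leq_add.
Qed.

(** [M] is the number of generators and [B] the loss in a product. The powers of exponent at most
    [M] of an element of gauge [e] have gauge [M * (e + B) + 1]; the formula is the size bound of
    [filt_dependent] at that gauge. *)
Definition inv_gauge M B e := ((M * (e + B) + 1).*2 * M + 1)%N.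

Section Filtration.
Variables (D : idomainType) (iota : {rmorphism {poly rat} -> D}).
Variables (I : finType) (v : I -> D).
Implicit Types (h g : D) (q : {poly rat}).

(* [h] is a combination of the [v i] whose coefficients are Laurent polynomials
   with exponents between [- e] and [e - 1]. *)
Definition filt e h := exists2 r : I -> {poly rat},
  forall i, (size (r i) <= e.*2)%N & iota ('X^e) * h = \sum_i iota (r i) * v i.

Lemma filt_choice (J : Type) (g : J -> D) e : (forall j, filt e (g j)) ->
  exists2 r : J -> I -> {poly rat}, forall j i, (size (r j i) <= e.*2)%N
    & forall j, iota ('X^e) * g j = \sum_i iota (r j i) * v i.
Proof.
move=> fg; have [|r rP] := choice (_ : forall j, exists r : I -> {poly rat},
    (forall i, (size (r i) <= e.*2)%N)
    /\ iota ('X^e) * g j = \sum_i iota (r i) * v i).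
  by move=> j; case: (fg j) => r szr rE; exists r.
by exists r => j; case: (rP j).
Qed.

(** Most gauge estimates reduce to this one. The coefficients [q j / 'X^a] have exponents between
    [- a] and [a], one more than gauge [a] allows; added to exponents between [- e] and [e - 1] they
    fit exactly into gauge [e + a]. *)
Lemma filt_lin (J : finType) (q : J -> {poly rat}) (g : J -> D) a e h :
  iota ('X^a) * h = \sum_j iota (q j) * g j ->
  (forall j, size (q j) <= a.*2.+1)%N -> (forall j, filt e (g j)) ->
  filt (e + a) h.
Proof.
move=> hE szq gr.
have [r szr rE] := filt_choice gr.
exists (fun i => \sum_j q j * r j i) => [i|].
  apply: (leq_trans (size_sum _ _ _)); apply/bigmax_leqP => j _.
  by apply: leq_trans (size_polyMleq _ _) _; move: (szq j) (szr j i); lia.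
rewrite exprD rmorphM -mulrA hE mulr_sumr.
under eq_bigr => j _ do rewrite mulrCA rE mulr_sumr.
rewrite exchange_big; apply: eq_bigr => i _ /=.
by rewrite rmorph_sum mulr_suml; apply: eq_bigr => j _; rewrite rmorphM mulrA.
Qed.

Lemma filt_lin1 q g a e h : iota ('X^a) * h = iota q * g ->
  (size q <= a.*2.+1)%N -> filt e g -> filt (e + a) h.
Proof.
move=> hE szq fg; apply: (@filt_lin 'I_1 (fun=> q) (fun=> g)) => //.
by rewrite big_ord1.
Qed.

Lemma filt_leq e e' h : (e <= e')%N -> filt e h -> filt e' h.
Proof.
move=> lee fh; rewrite -(subnKC lee); apply: filt_lin1 fh => //.
by rewrite size_polyXn; lia.
Qed.

Lemma filt_div a e h : filt e (iota ('X^a) * h) -> filt (e + a) h.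
Proof.
by apply: filt_lin1 (1 : {poly rat}) _ _ _ _ _ _;
  rewrite ?rmorph1 ?mul1r ?size_poly1.
Qed.

Lemma filt_scale a e q h :
  (size q <= a.+1)%N -> filt e h -> filt (e + a) (iota q * h).
Proof.
move=> szq; apply: (@filt_lin1 ('X^a * q)); first by rewrite rmorphM mulrA.
by apply: leq_trans (size_polyMleq _ _) _; rewrite size_polyXn; lia.
Qed.

Lemma filt_scaleC e (c : rat) h : filt e h -> filt e (iota c%:P * h).
Proof. by rewrite -{2}[e]addn0; apply: filt_scale;
  rewrite size_polyC leq_b1. Qed.

Lemma filt_sum (J : finType) e (P : pred J) (g : J -> D) :
  (forall j, P j -> filt e (g j)) -> filt e (\sum_(j | P j) g j).
Proof.
move=> fg; rewrite -[e]addn0.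
apply: (@filt_lin J (fun j => (P j)%:R) (fun j => if P j then g j else 0)).
- rewrite rmorph1 mul1r big_mkcond; apply: eq_bigr => j _.
  by case: ifP; rewrite ?rmorph1 ?rmorph0 ?mul1r ?mul0r.
- by move=> j; case: (P j); rewrite ?size_poly1 ?size_poly0.
- move=> j; case: ifP => [/fg //|_]; exists (fun=> 0) => [i|].
    by rewrite size_poly0.
  by rewrite mulr0 big1 // => i _; rewrite rmorph0 mul0r.
Qed.

Lemma filtD e g h : filt e g -> filt e h -> filt e (g + h).
Proof.
move=> fg fh; have -> : g + h = \sum_(b : bool) if b then g else h.
  by rewrite (bigD1 true) //= (big_pred1 false) // => -[].
by apply: filt_sum => -[].
Qed.

Lemma filtN e h : filt e h -> filt e (- h).
Proof.
have -> : - h = iota (-1)%:P * h by rewrite polyCN rmorphN rmorph1 mulN1r.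
exact: filt_scaleC.
Qed.

Lemma filtB e g h : filt e g -> filt e h -> filt e (g - h).
Proof. by move=> fg fh; apply/filtD/filtN. Qed.

Hypothesis iotaX : iota 'X != 0.

Lemma iotaXn a : iota ('X^a) != 0.
Proof. by rewrite rmorphXn expf_neq0. Qed.

Lemma filt_dependent e (h : 'I_(#|I|).+1 -> D) : (forall j, filt e (h j)) ->
  exists q : 'I_(#|I|).+1 -> {poly rat},
    [/\ exists j, q j != 0, forall j, (size (q j) <= e.*2 * #|I| + 1)%N
      & \sum_j iota (q j) * h j = 0].
Proof.
move=> fh.
have [r szr rE] := filt_choice fh.
have [q [nzq szq qr]] := poly_rows_dependent szr.
exists q; split=> //; apply: (mulfI (iotaXn e)); rewrite mulr0 mulr_sumr.
transitivity (\sum_i iota (\sum_j q j * r j i) * v i); last first.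
  by rewrite big1 // => i _; rewrite qr rmorph0 mul0r.
under eq_bigr => j _ do rewrite mulrCA rE mulr_sumr.
rewrite exchange_big; apply: eq_bigr => i _ /=.
by rewrite rmorph_sum mulr_suml; apply: eq_bigr => j _; rewrite rmorphM mulrA.
Qed.

Section Algebra.
Variable B : nat.
Hypothesis filt1 : filt 1 1.
Hypothesis filtM : forall e e' g h,
  filt e g -> filt e' h -> filt (e + e' + B) (g * h).

Lemma filtX e h j : filt e h -> filt (j * (e + B) + 1) (h ^+ j).
Proof.
move=> fh; elim: j => [|j IHj]; first by rewrite expr0.
by rewrite exprS; apply: filt_leq (filtM fh IHj); lia.
Qed.

Lemma filt_prod (J : finType) (P : pred J) e (g : J -> D) :
  (forall j, filt e (g j)) ->
  filt (#|J| * (e + B) + 1) (\prod_(j | P j) g j).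
Proof.
move=> fg; apply: (@filt_leq (#|P| * (e + B) + 1)).
  by rewrite leq_add2r leq_mul2r max_card orbT.
rewrite -sum1_card; elim/big_rec2: _ => [|j h n _ fh]; first by rewrite mul0n.
by apply: filt_leq (filtM (fg j) fh); lia.
Qed.

(* The powers of [h] are dependent; the lowest nonzero coefficient of a
   relation between them is a multiple of [h]. *)
Lemma filt_inverse e h : filt e h -> h != 0 ->
  exists q g, [/\ q != 0, (size q <= inv_gauge #|I| B e)%N,
    filt (#|I| * (e + B) + 1 + inv_gauge #|I| B e) g & h * g = iota q].
Proof.
move=> fh nzh; set E := (#|I| * (e + B) + 1)%N.
have fX (j : 'I_(#|I|).+1) : filt E (h ^+ j).
  by apply: filt_leq (filtX j fh); rewrite leq_add2r leq_mul2r -ltnS ltn_ord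
    orbT.
have [q [[j1 nzq] szq qh]] := filt_dependent fX.
case: (@arg_minnP _ j1 (fun j => q j != 0) (@nat_of_ord _) nzq) =>
  i0 nzi0 min_i0.
have q0 (j : 'I_(#|I|).+1) : (j < i0)%N -> q j = 0.
  by move=> lt; apply: contraTeq lt => /min_i0; rewrite -leqNgt.
pose g := - \sum_(j : 'I_(#|I|).+1 | (i0 < j)%N) iota (q j) * h ^+ (j - i0.+1).
exists (q i0), g; split=> //.
  apply/filtN/filt_sum => j ltj; apply: filt_scale; first exact: leqW.
  apply: filt_leq (filtX _ fh); rewrite leq_add2r leq_mul2r; apply/orP; right.
  by have := ltn_ord j; lia.
apply: (mulfI (expf_neq0 i0 nzh)); rewrite mulrA -exprSr.
apply/eqP; rewrite eq_sym -subr_eq0 -[X in _ == X]qh; apply/eqP.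
rewrite (bigID (fun j : 'I__ => (j < i0)%N)) /= big1 ?add0r; last first.
  by move=> j /q0 ->; rewrite rmorph0 mul0r.
rewrite (bigD1 i0) ?ltnn //= mulrC; congr (_ + _).
rewrite /g mulrN opprK mulr_sumr; apply: eq_big => [j|j ltj].
  by rewrite -leqNgt ltn_neqAle andbC eq_sym.
by rewrite mulrCA -exprD subnKC.
Qed.

End Algebra.
End Filtration.

(** * Derivations on algebras generated by algebraic elements *)

(** Bounds for [d] roots of degree [m], hence [m ^ d] monomials, as closed arithmetic expressions so
    that they are computable. They bound: the cost of multiplying by a monomial; products of the
    [kappa k]; the size of [delta]; the gauge of [delta * theta (z k)]; the loss under
    [delta * theta]; the gauge of an operator of order below [R] applied to [E], cleared by
    [delta ^+ R]; the size of a polynomial divisible by the value of such an operator. *)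
Definition mul_gauge d m := (d * m).*2.
Definition kappa_gauge d m ek := (d * (ek + mul_gauge d m) + 1)%N.
Definition delta_gauge d m ek :=
  inv_gauge (m ^ d) (mul_gauge d m) (kappa_gauge d m ek).
Definition root_gauge d m ek :=
  (kappa_gauge d m ek
   + (m ^ d * (kappa_gauge d m ek + mul_gauge d m) + 1 + delta_gauge d m ek)
   + mul_gauge d m + d.*2)%N.
Definition theta_gauge d m ek :=
  (root_gauge d m ek + mul_gauge d m + delta_gauge d m ek + 1)%N.
Definition ode_gauge d m ek R L :=
  (d.*2 + 2 + R * theta_gauge d m ek + L + 1)%N.
Definition check_gauge d m ek R L :=
  inv_gauge (m ^ d) (mul_gauge d m) (ode_gauge d m ek R L).

Section Monomials.
Variables (D : idomainType) (iota : {rmorphism {poly rat} -> D}).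
Hypothesis iotaX : iota 'X != 0.
Variables (d m : nat) (z : 'I_d -> D) (rho : 'I_m -> {poly rat}).
Hypothesis m_gt0 : (0 < m)%N.
Hypothesis size_rho : forall j, (size (rho j) <= 3)%N.
Hypothesis z_rho :
  forall k, iota 'X * z k ^+ m = \sum_j iota (rho j) * z k ^+ j.

Local Notation mono := {ffun 'I_d -> 'I_m}.

Definition monomial (phi : mono) : D := \prod_k z k ^+ phi k.

Local Notation filt := (filt iota monomial).

Lemma filt_monomial phi : filt 1 (monomial phi).
Proof.
(* Exponents stop at [e - 1], so the constant coefficient 1 already needs gauge 1; clearing ['X^1]
   turns it into ['X]. *)
exists (fun psi => (psi == phi)%:R * 'X) => [psi|].
  by case: eqP; rewrite ?mul1r ?mul0r ?size_polyX ?size_poly0.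
rewrite (bigD1 phi) //= eqxx mul1r expr1 big1 ?addr0 // => psi /negPf ->.
by rewrite mul0r rmorph0 mul0r.
Qed.

Lemma filt_one : filt 1 1.
Proof.
suff <- : monomial [ffun=> Ordinal m_gt0] = 1 by apply: filt_monomial.
by rewrite /monomial big1 // => k _; rewrite ffunE expr0.
Qed.

Local Notation Gmul := (mul_gauge d m).

(** Costs of multiplication operators simply add under products, while [filt_mul] loses a further
    [Gmul] at each use. *)
Definition mulcost n h := forall e g, filt e g -> filt (e + n) (h * g).

Lemma mulcost1 : mulcost 0 1.
Proof. by move=> e g; rewrite addn0 mul1r. Qed.

Lemma mulcostM a b g h : mulcost a g -> mulcost b h -> mulcost (a + b) (g * h).
Proof. by move=> cg ch e x fx; rewrite -mulrA [(a + b)%N]addnC addnA; auto. Qed.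

Lemma mulcost_leq a b h : (a <= b)%N -> mulcost a h -> mulcost b h.
Proof. by move=> leab ch e x fx; apply: filt_leq (ch e x fx);
  rewrite leq_add2l. Qed.

Lemma mulcostX a h n : mulcost a h -> mulcost (a * n) (h ^+ n).
Proof.
move=> ch; elim: n => [|n IHn]; first by rewrite muln0 expr0; apply: mulcost1.
by rewrite mulnS exprS; apply: mulcostM.
Qed.

Lemma filt_mulcost a h : mulcost a h -> filt a.+1 h.
Proof. by move=> /(_ 1 1 filt_one); rewrite mulr1. Qed.

(** The product of [z k] and a monomial is either a monomial, of gauge 1, or reaches exponent [m];
    the relation then divides once by ['X] and gives gauge 2. The size bound 3 on [rho] is the
    [a.*2.+1] of [filt_lin] at [a = 1]. *)
Lemma mulcost_z k : mulcost 2 (z k).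
Proof.
pose upd (phi : mono) j : mono := [ffun i => if i == k then j else phi i].
have updE phi j : monomial (upd phi j) = z k ^+ j * \prod_(i | i != k) z i ^+
  phi i.
  rewrite /monomial (bigD1 k) //= ffunE eqxx; congr (_ * _).
  by apply: eq_bigr => i /negPf nik; rewrite ffunE nik.
have zphi phi : filt 2 (z k * monomial phi).
  have -> : z k * monomial phi = z k ^+ (phi k).+1 * \prod_(i | i != k) z i ^+
    phi i.
    by rewrite /monomial (bigD1 k) //= exprS mulrA.
  have := ltn_ord (phi k); rewrite leq_eqVlt => /orP[/eqP ->|lt_m].
    apply: (@filt_lin _ iota _ _ _ rho (fun j => monomial (upd phi j)) 1 1) =>
      //.
      rewrite expr1 mulrA z_rho mulr_suml; apply: eq_bigr => j _.
      by rewrite updE mulrA.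
    by move=> j; apply: filt_monomial.
  apply: (@filt_leq _ iota _ _ 1) => //.
  by rewrite -(updE _ (Ordinal lt_m)); apply: filt_monomial.
move=> e g [r szr rE]; rewrite addnC.
apply: (@filt_lin _ iota _ _ _ r (fun phi => z k * monomial phi)) => //.
  by rewrite mulrCA rE mulr_sumr; apply: eq_bigr => i _; rewrite mulrCA.
by move=> phi; apply: leqW.
Qed.

Lemma mulcost_monomial phi : mulcost Gmul (monomial phi).
Proof.
apply: (@mulcost_leq (\sum_k 2 * phi k)).
  rewrite -big_distrr /= mul2n leq_double -[d in (_ <= d * _)%N]card_ord.
  by rewrite -sum_nat_const; apply: leq_sum => k _; apply: ltnW.
rewrite /monomial; elim/big_rec2: _ => [|k h a _ ch]; first exact: mulcost1.
by apply: mulcostM => //; apply/mulcostX/mulcost_z.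
Qed.

Lemma filt_mul e e' g h :
  filt e g -> filt e' h -> filt (e + e' + Gmul) (g * h).
Proof.
case=> r szr rE fh.
have -> : (e + e' + Gmul = e' + Gmul + e)%N by lia.
apply: (@filt_lin _ iota _ _ _ r (fun phi => monomial phi * h)).
- by rewrite mulrA rE mulr_suml; apply: eq_bigr => phi _; rewrite mulrA.
- by move=> phi; apply: leqW.
- by move=> phi; apply: mulcost_monomial.
Qed.

Lemma filt_inv e h : filt e h -> h != 0 ->
  exists (q : {poly rat}) (g : D), [/\ q != 0, (size q <= inv_gauge (m ^ d)
    Gmul e)%N,
    filt (m ^ d * (e + Gmul) + 1 + inv_gauge (m ^ d) Gmul e) g
    & h * g = iota q].
Proof.
have <- : #|mono| = (m ^ d)%N by rewrite card_ffun !card_ord.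
exact: (filt_inverse iotaX filt_one filt_mul).
Qed.

Variable theta : {additive D -> D}.
Hypothesis thetaM : forall g h, theta (g * h) = theta g * h + g * theta h.
Hypothesis theta_iota : forall q, theta (iota q) = iota ('X * q^`()).
Variables (kappa : 'I_d -> D) (ek : nat).
Hypothesis filt_kappa : forall k, filt ek (kappa k).
Hypothesis kappa_neq0 : forall k, kappa k != 0.
Hypothesis kappaE : forall k, theta (z k) * kappa k = z k ^+ d.

Local Notation Gkappa := (kappa_gauge d m ek).
Local Notation Gdelta := (delta_gauge d m ek).
Local Notation Groot := (root_gauge d m ek).
Local Notation Gtheta := (theta_gauge d m ek).

Lemma theta1 : theta 1 = 0.
Proof. by rewrite -(rmorph1 iota) theta_iota derivC mulr0 rmorph0. Qed.

Lemma size_mulX_deriv (q : {poly rat}) : (size ('X * q^`())%R <= size q)%N.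
Proof.
case: (eqVneq q 0) => [->|nzq]; first by rewrite deriv0 mulr0.
rewrite mulrC; have [->|nz] := eqVneq q^`() 0; first
  by rewrite mul0r size_poly0.
by rewrite size_mulX // lt_size_deriv.
Qed.

(** Inverting the product of all the [kappa k] at once yields a common denominator: if [delta] is
    that product times [g], then [delta * theta (z k)] is [z k ^+ d] times [g] times the other
    [kappa j]. *)
Lemma delta_exists : exists delta : {poly rat},
  [/\ delta != 0, (size delta <= Gdelta)%N
    & forall k, filt Groot (iota delta * theta (z k))].
Proof.
have fP P : filt Gkappa (\prod_(k | P k) kappa k).
  by have := filt_prod iotaX filt_one filt_mul P filt_kappa; rewrite card_ord.
have nzP : \prod_k kappa k != 0 by apply/prodf_neq0 => k _.
have [delta [g [nzd szd fg dE]]] := filt_inv (fP xpredT) nzP.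
exists delta; split=> // k.
have -> : iota delta * theta (z k)
    = z k ^+ d * ((\prod_(j | j != k) kappa j) * g).
  by rewrite -dE -kappaE (bigD1 k) //=; ring.
by rewrite /root_gauge -mul2n; apply/(mulcostX d (mulcost_z k))/filt_mul.
Qed.

Section Delta.
Variable delta : {poly rat}.
Hypothesis size_delta : (size delta <= Gdelta)%N.
Hypothesis delta_z : forall k, filt Groot (iota delta * theta (z k)).

(* The number [n] bounds the loss of filtration both in multiplying by [h] and
   in passing from the [z k] to [h] under [iota delta * theta _]. *)
Definition tamed n h :=
  mulcost n h /\ filt (Groot + n) (iota delta * theta h).

Lemma tamed1 : tamed 0 1.
Proof.
split; first exact: mulcost1.
rewrite theta1 mulr0 -(mul0r 1) -(rmorph0 iota) -polyC0.
by apply: filt_scaleC; apply: filt_leq filt_one; rewrite /root_gauge; lia.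
Qed.

Lemma tamedM a b g h : tamed a g -> tamed b h -> tamed (a + b) (g * h).
Proof.
move=> [cg tg] [ch th]; split; first exact: mulcostM.
have -> : iota delta * theta (g * h)
    = h * (iota delta * theta g) + g * (iota delta * theta h).
  by rewrite thetaM; ring.
apply: filtD; first by rewrite addnA; apply: ch.
by rewrite [(a + b)%N]addnC addnA; apply: cg.
Qed.

Lemma tamed_z k : tamed 2 (z k).
Proof.
by split; [apply: mulcost_z | apply: filt_leq (delta_z k); rewrite leq_addr].
Qed.

Lemma tamedX a h n : tamed a h -> tamed (n * a) (h ^+ n).
Proof.
move=> th; elim: n => [|n IHn]; first by rewrite mul0n expr0; apply: tamed1.
by rewrite mulSn exprS; apply: tamedM.
Qed.

Lemma filt_theta_monomial phi :
  filt (Groot + Gmul) (iota delta * theta (monomial phi)).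
Proof.
have [_] : tamed (\sum_k phi k * 2) (monomial phi).
  rewrite /monomial; elim/big_rec2: _ => [|k h a _ ch]; first exact: tamed1.
  by apply: tamedM => //; apply/tamedX/tamed_z.
apply: filt_leq; rewrite leq_add2l -big_distrl /= muln2 leq_double.
rewrite -[d in (_ <= d * _)%N]card_ord.
by rewrite -sum_nat_const; apply: leq_sum => k _; apply: ltnW.
Qed.

Lemma filt_theta e h :
  filt e h -> filt (e + Gtheta) (iota delta * theta h).
Proof.
move=> fh; have [r szr rE] := fh.
(* Since [theta ('X^e * h) = 'X^e * (theta h + e * h)], the shifted element is the one obtained by
   differentiating the expansion of ['X^e * h] termwise. *)
suff fy : filt (e + Gtheta) (iota delta * theta h + iota (e%:R) * (iota delta
  * h)).
  rewrite -[X in filt _ X](addrK (iota e%:R * (iota delta * h))).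
  apply: filtB => //; rewrite -polyC_natr; apply: filt_scaleC.
  apply: filt_leq (filt_scale (leqW size_delta) fh).
  by rewrite leq_add2l /theta_gauge; lia.
rewrite [(e + _)%N]addnC.
(* The two summands index the two terms of the product rule. *)
pose q (j : mono + mono) := match j with inl i => 'X * (r i)^`() | inr i =>
  r i end.
pose g (j : mono + mono) := match j with inl i => iota delta * monomial i
  | inr i => iota delta * theta (monomial i) end.
apply: (@filt_lin _ iota _ _ _ q g) => [|[i|i]|[i|i]] /=.
- rewrite big_sumType /= -big_split /=.
  transitivity (iota delta * theta (iota 'X^e * h)).
    rewrite thetaM theta_iota derivXn.
    have -> : 'X * ('X^(e.-1) *+ e) = e%:R * 'X^e :> {poly rat}.
      by case: e {fh szr rE} => [|e]; rewrite ?mulr0n ?mulr0 ?mul0r // mulrnAr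
        -exprS mulr_natl.
    by rewrite rmorphM; ring.
  rewrite rE raddf_sum mulr_sumr; apply: eq_bigr => i _.
  by rewrite thetaM theta_iota; ring.
- by apply: leqW; apply: leq_trans (size_mulX_deriv _) (szr i).
- exact: leqW.
- apply: filt_leq (filt_scale (leqW size_delta) (filt_monomial i)).
  by rewrite /theta_gauge; lia.
- by apply: filt_leq (filt_theta_monomial i); rewrite /theta_gauge; lia.
Qed.

Variables (E : D) (eE : nat).
Hypothesis filt_E : filt eE E.

(** Commuting [theta] with [delta ^+ k] leaves the term [k * 'X * delta^]() * delta ^+
    k[. The size of]'X * delta^[()] is at most that of [delta], so each iteration costs one
    [Gtheta]. *)
Lemma filt_iter_theta k :
  filt (eE + k * Gtheta) (iota (delta ^+ k) * iter k theta E).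
Proof.
elim: k => [|k IHk]; first by rewrite addn0 expr0 rmorph1 mul1r.
set x := iter k theta E in IHk *.
have -> : iota (delta ^+ k.+1) * iter k.+1 theta E
    = iota delta * theta (iota (delta ^+ k) * x)
      - iota ('X * delta^`() *+ k) * (iota (delta ^+ k) * x).
  rewrite thetaM theta_iota deriv_exp /= -/x exprS.
  case: k {IHk x} (x) => [|k] x; rewrite ?mulr0n ?mulr0 ?rmorph0 ?mul0r.
    by rewrite !rmorphM; ring.
  rewrite /= !rmorphM !rmorphMn !rmorphM exprS rmorphM /=; ring.
rewrite mulSn addnCA addnC; apply: filtB; first exact: filt_theta.
apply: filt_leq (filt_scale _ IHk); last first.
  rewrite -scaler_nat.
  apply: leq_trans (size_scale_leq _ _) _; apply: leqW.
  exact: leq_trans (size_mulX_deriv _) size_delta.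
by rewrite leq_add2l /theta_gauge; lia.
Qed.

Lemma filt_iter_theta_leq k n : (k <= n)%N ->
  filt (eE + n * Gtheta) (iota (delta ^+ n) * iter k theta E).
Proof.
move=> lekn; rewrite -{2}(subnK lekn) exprD rmorphM -mulrA.
have szd : (size (delta ^+ (n - k))%R <= (Gdelta * (n - k)).+1)%N.
  apply: leq_trans (size_poly_exp_leq _ _) _.
  by rewrite ltnS leq_mul2r (leq_trans (leq_pred _)) ?orbT.
apply: filt_leq (filt_scale szd (filt_iter_theta k)).
rewrite -addnA leq_add2l -[in X in (_ <= X)%N](subnKC lekn) mulnDl leq_add2l.
by rewrite mulnC leq_mul2l /theta_gauge; lia.
Qed.

End Delta.

Variables (E : D) (c : rat).
Hypothesis tE : iota 'X * E = iota c%:P * \prod_k z k.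
Hypothesis iota_neq0 : forall q, q != 0 -> iota q != 0.

(** The gauge counts 2 for each of the [d] roots, 1 for the gauge of the unit, and 1 for the
    division by ['X]. *)
Lemma filt_root_product : filt (d.*2 + 2) E.
Proof.
have -> : (d.*2 + 2 = d.*2.+1 + 1)%N by lia.
apply: filt_div.
rewrite expr1 tE; apply/filt_scaleC/filt_mulcost.
apply: (@mulcost_leq (\sum_(k < d) 2)).
  by rewrite sum_nat_const card_ord muln2.
elim/big_rec2: _ => [|k h a _ ch]; first exact: mulcost1.
by apply: mulcostM => //; apply: mulcost_z.
Qed.

(** Cleared by the common factor [delta ^+ (m ^ d)], the iterates of order at most [m ^ d] outnumber
    the monomials by one. *)
Lemma ode_exists : exists q : 'I_(m ^ d).+1 -> {poly rat},
  (exists j, q j != 0) /\ \sum_j iota (q j) * iter j theta E = 0.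
Proof.
have [delta [nzd szd dz]] := delta_exists.
have := @filt_dependent _ iota _ monomial iotaX (d.*2 + 2 + m ^ d * Gtheta)
  (fun j => iota (delta ^+ (m ^ d)) * iter j theta E).
rewrite card_ffun !card_ord => /(_ _)[j|q [nzq _ qE]].
  by apply: filt_iter_theta_leq filt_root_product _ _ _ => //; rewrite -ltnS.
exists q; split=> //; apply: (mulfI (iota_neq0 (expf_neq0 (m ^ d) nzd))).
by rewrite mulr0 -[RHS]qE mulr_sumr; apply: eq_bigr => j _; rewrite mulrCA.
Qed.

(** The zero test: an element that divides a nonzero polynomial of known size cannot vanish to
    arbitrarily high order. The polynomial [w0] accounts for the initial coefficients on which
    nothing is demanded. *)
Lemma ode_check R L (w : 'I_R -> {poly rat}) (w0 : {poly rat}) :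
  (forall j, (size (w j) <= L.+1)%N) -> (size w0 <= L.+1)%N ->
  \sum_j iota (w j) * iter j theta E - iota w0 != 0 ->
  exists (q : {poly rat}) (g : D),
    [/\ q != 0, (size q <= check_gauge d m ek R L)%N
      & (\sum_j iota (w j) * iter j theta E - iota w0) * g = iota q].
Proof.
set H := (_ - _) => szw szw0 nzH.
have [delta [nzd szd dz]] := delta_exists.
have nzdR := expf_neq0 R nzd.
have fdR : filt (R * Gtheta + 1) (iota (delta ^+ R)).
  rewrite -[iota _]mulr1 addnC.
  apply: filt_leq (filt_scale (size_poly_exp_leq _ _) filt_one).
  rewrite leq_add2l [(R * _)%N]mulnC leq_mul2r (leq_trans (leq_pred _)) ?orbT
    //.
  by apply: leq_trans szd _; rewrite /theta_gauge; lia.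
have fH : filt (ode_gauge d m ek R L) (iota (delta ^+ R) * H).
  rewrite mulrBr mulr_sumr; apply: filtB.
    apply: filt_sum => j _; rewrite mulrCA.
    have fj := filt_iter_theta_leq szd dz filt_root_product (ltnW (ltn_ord j)).
    by apply: filt_leq (filt_scale (szw j) fj); rewrite /ode_gauge; lia.
  rewrite mulrC; apply: filt_leq (filt_scale szw0 fdR).
  by rewrite /ode_gauge; lia.
have [|q [g [nzq szq _ qE]]] := filt_inv fH.
  by rewrite mulf_neq0 // iota_neq0.
by exists q, (iota (delta ^+ R) * g); split=> //; rewrite -qE; ring.
Qed.

End Monomials.

(** * Kernel method *)

(** Counts the walks that start at level [- h], never exceed level 0 and end there; [h] is the
    current distance below the ceiling. *)
Fixpoint walks_to_zero (s : seq int) (n h : nat) : nat :=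
  if n is n'.+1 then
    (\sum_(x <- s | (x <= h%:Z)%R) walks_to_zero s n' `|(h%:Z - x)%R|)%N
  else (h == 0%N).

Definition max_step (s : seq int) : nat := (\max_(x <- s) `|x|)%N.
Definition step_down (x : int) : nat := if x is Negz k then k.+1 else 0%N.
Definition max_down (s : seq int) : nat := (\max_(x <- s) step_down x)%N.

Lemma leq_max_step s x : x \in s -> (`|x| <= max_step s)%N.
Proof. by move=> xs; apply: leq_bigmax_seq. Qed.

Lemma walks_to_zero_big s n h : (n * max_step s < h)%N ->
  walks_to_zero s n h = 0%N.
Proof.
elim: n h => [|n IHn] h lth /=; first by case: h lth.
rewrite big_seq_cond big1 // => x /andP[/leq_max_step xs lexh].
by apply: IHn; move: lth; rewrite mulSn; lia.
Qed.

(** * Evaluation of rational polynomials at power series *)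

Section Evaluation.
Variables (R : numFieldType).
Implicit Types (f y : fps R) (p : {poly rat}).

Definition fps_rat : rat -> fps R := @fps_const R \o ratr.
HB.instance Definition _ := GRing.RMorphism.on fps_rat.

Definition fps_eval y : {poly rat} -> fps R :=
  horner_eval y \o map_poly fps_rat.
HB.instance Definition _ y := GRing.RMorphism.on (fps_eval y).
Arguments fps_eval : simpl never.

Lemma fps_evalC y c : fps_eval y c%:P = fps_rat c.
Proof. by rewrite /fps_eval /= map_polyC /horner_eval hornerC. Qed.

Lemma fps_evalX y : fps_eval y 'X = y.
Proof. by rewrite /fps_eval /= map_polyX /horner_eval hornerX. Qed.

Lemma fps_evalE y p N : (size p <= N)%N ->
  fps_eval y p = \sum_(i < N) fps_rat p`_i * y ^+ i.
Proof.
move=> szp; rewrite /fps_eval /= /horner_eval (@horner_coef_wide _ N);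
  last first.
  exact: leq_trans (size_poly _ _) szp.
by apply: eq_bigr => i _; rewrite coef_map.
Qed.

Lemma fps_eqm_eval n y y' p : fps_eqm n y y' ->
  fps_eqm n (fps_eval y p) (fps_eval y' p).
Proof.
move=> yy i lti; rewrite !(fps_evalE _ (leqnn _)) !fcoef_sum.
by apply: eq_bigr => j _; apply: fps_eqmM lti => //; apply: fps_eqmX.
Qed.

(** Substitution of [a * X] for [X]; at powers of a root of unity it produces the conjugate
    roots. *)
Definition fps_scale (a : R) f : fps R := Fps (fun n => a ^+ n * f n).

Fact fps_scale_zmod a : zmod_morphism (fps_scale a).
Proof. by move=> f g; apply/fpsP => n; apply: mulrBr. Qed.
Fact fps_scale_monoid a : monoid_morphism (fps_scale a).
Proof.
split=> [|f g]; apply/fpsP => n.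
  by rewrite /=; case: n => [|n]; rewrite ?expr0 ?mul1r ?mulr0.
rewrite [RHS]fcoefM /= mulr_sumr; apply: eq_bigr => i _ /=.
by rewrite -{1}(subnKC (leq_ord i)) exprD; ring.
Qed.
HB.instance Definition _ a :=
  GRing.isZmodMorphism.Build (fps R) (fps R) (fps_scale a) (fps_scale_zmod a).
HB.instance Definition _ a :=
  GRing.isMonoidMorphism.Build (fps R) (fps R) (fps_scale a) (fps_scale_monoid
    a).

Lemma fps_scale_eval a y p : fps_scale a (fps_eval y p) = fps_eval (fps_scale
  a y) p.
Proof.
rewrite !(fps_evalE _ (leqnn _)) rmorph_sum; apply: eq_bigr => i _.
rewrite rmorphM rmorphXn; congr (_ * _); apply/fpsP => n.
by rewrite /= /fps_rat /=; case: n => [|n]; rewrite ?mul1r ?mulr0.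
Qed.

Variable d : nat.
Hypothesis d_gt0 : (0 < d)%N.

Lemma natd_neq0 : d%:R != 0 :> R. Proof. by rewrite pnatr_eq0 -lt0n. Qed.

(* The derivation [t d/dt] for [t = 'X^d]. *)
Definition fps_theta f : fps R := Fps (fun n => n%:R / d%:R * f n).

Fact fps_theta_zmod : zmod_morphism fps_theta.
Proof. by move=> f g; apply/fpsP => n; apply: mulrBr. Qed.
HB.instance Definition _ :=
  GRing.isZmodMorphism.Build (fps R) (fps R) fps_theta fps_theta_zmod.

Lemma fps_thetaM f g : fps_theta (f * g) = fps_theta f * g + f * fps_theta g.
Proof.
apply/fpsP => n; rewrite fcoefD !fcoefM /= mulr_sumr -big_split.
apply: eq_bigr => i _ /=; rewrite -{1}(subnKC (leq_ord i)) natrD.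
by field; rewrite natd_neq0.
Qed.

Lemma fps_theta_rat c : fps_theta (fps_rat c) = 0.
Proof. by apply/fpsP => -[|n]; rewrite /= ?mul0r ?mul0r ?mulr0. Qed.

Lemma fps_theta_eval y p : fps_theta (fps_eval y p) = fps_eval y p^`() *
  fps_theta y.
Proof.
elim/poly_ind: p => [|p c IHp]; first by rewrite deriv0 rmorph0 raddf0 mul0r.
rewrite derivD derivC addr0 derivM derivX mulr1 !rmorphD !rmorphM /= fps_evalC
  fps_evalX.
by rewrite raddfD /= fps_theta_rat fps_thetaM IHp; ring.
Qed.

Local Notation T := (fps_X R ^+ d).

Lemma fps_theta_T : fps_theta T = T.
Proof.
apply/fpsP => n /=; rewrite -[T]mulr1 fcoefXnM.
case: leqP => [led|]; last by rewrite mulr0.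
have [->|nd] := eqVneq n d; first by rewrite mulfV ?natd_neq0 // mul1r.
by rewrite /= mulrb ifN ?mulr0 // subn_eq0 -ltnNge ltn_neqAle eq_sym nd.
Qed.

Lemma fps_eval_TM p f n : (fps_eval T p * f) n =
  \sum_(i < n.+1 | (d * i <= n)%N) ratr p`_i * f (n - d * i)%N.
Proof.
pose N := maxn (size p) n.+1; rewrite (@fps_evalE _ _ N) ?leq_maxl //.
rewrite mulr_suml fcoef_sum (big_ord_widen_cond N (fun i => (d * i <= n)%N)
  (fun i => ratr p`_i * f (n - d * i)%N)) ?leq_maxr // [RHS]big_mkcond.
apply: eq_bigr => i _; rewrite -mulrA fcoefCM -exprM fcoefXnM.
case: (leqP (d * i) n) => [le_din|]; last by rewrite mulr0.
suff -> : (i < n.+1)%N by [].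
by rewrite ltnS (leq_trans _ le_din) // leq_pmull.
Qed.

Lemma fps_eval_T p i : fps_eval T p (d * i)%N = ratr p`_i.
Proof.
rewrite -[fps_eval T p]mulr1 fps_eval_TM.
have lti : (i < (d * i).+1)%N by rewrite ltnS leq_pmull.
rewrite (bigD1 (Ordinal lti)) //= subnn mulr1 big1 ?addr0 // =>
  j /andP[lej nej].
rewrite /= mulrb ifN ?mulr0 // subn_eq0 leq_pmul2l // -ltnNge ltn_neqAle.
by rewrite -(leq_pmul2l d_gt0) lej andbT.
Qed.

Lemma fps_eval_T_eq0 p N : (size p <= N)%N ->
  fps_eqm (d * N) (fps_eval T p) 0 -> p = 0.
Proof.
move=> szp p0; apply/polyP => i; rewrite coef0.
have [ltiN|leNi] := ltnP i N; last by rewrite nth_default // (leq_trans szp).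
have := fps_eval_T p i; rewrite p0 ?ltn_pmul2l // => /esym/eqP.
by rewrite fmorph_eq0 => /eqP.
Qed.

Lemma fps_eval_T_neq0 p : p != 0 -> fps_eval T p != 0.
Proof.
apply: contraNneq => p0; apply/eqP/(fps_eval_T_eq0 (leqnn _)) => i _.
by rewrite p0.
Qed.

Definition fps_in_T (a : nat -> R) : fps R :=
  Fps (fun n => if (d %| n)%N then a (n %/ d)%N else 0).

Lemma fps_in_T_eqm a N :
  fps_eqm N (fps_in_T a) (\sum_(n < N) T ^+ n * fps_const (a n)).
Proof.
move=> i ltiN; rewrite fcoef_sum.
under eq_bigr => n _ do rewrite -exprM fcoefXnM.
rewrite /=.
have [/dvdnP[k]|ndvd] := boolP (d %| i)%N.
  rewrite mulnC => ik; rewrite ik mulKn //.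
  have ltkN : (k < N)%N by apply: leq_ltn_trans ltiN; rewrite ik leq_pmull.
  rewrite (bigD1 (Ordinal ltkN)) //= leqnn subnn mulr1n big1 ?addr0 //.
  move=> n nek; case: leqP => // le_nk; rewrite mulrb ifN // subn_eq0.
  rewrite leq_pmul2l // -ltnNge ltn_neqAle -(leq_pmul2l d_gt0) le_nk andbT.
  by apply: contraNneq nek => nk; apply/eqP/val_inj.
rewrite big1 // => n _; case: leqP => // le_ni /=; rewrite mulrb ifN //.
by rewrite subn_eq0 -ltnNge ltn_neqAle le_ni andbT; apply: contraNneq ndvd =>
  <-;
   apply: dvdn_mulr.
Qed.

Lemma fps_eqm_TM N f : fps_eqm N (T ^+ N * f) 0.
Proof.
move=> i ltiN; rewrite -exprM fcoefXnM leqNgt ifN // negbK.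
by apply: leq_trans ltiN _; rewrite leq_pmull.
Qed.

End Evaluation.

(** * Generating polynomials of steps and walks *)

Lemma max_down_mem s : (0 < max_down s)%N -> - (max_down s)%:Z \in s.
Proof.
rewrite /max_down; elim: s => [|x s IHs]; first by rewrite big_nil.
rewrite big_cons inE; case: (leqP (step_down x)) => [_ /IHs ->|_].
  by rewrite orbT.
by case: x => // k _; rewrite NegzE eqxx.
Qed.

Lemma max_down_ge s x : x \in s -> - (max_down s)%:Z <= x.
Proof.
move=> xs; have : (step_down x <= max_down s)%N by apply: leq_bigmax_seq.
by case: x {xs} => k /=; lia.
Qed.

Section StepPolynomial.
Variable s : seq int.
Local Notation d := (max_down s).

Definition step_poly : {poly rat} := \sum_(x <- s) 'X^`|(d%:Z + x)%R|.

Definition walk_poly n : {poly rat} :=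
  \poly_(h < (n * max_step s).+1) (walks_to_zero s n h)%:R.

Lemma coef_walk_poly n h : (walk_poly n)`_h = (walks_to_zero s n h)%:R.
Proof.
by rewrite coef_poly ltnS; case: leqP => // /walks_to_zero_big ->.
Qed.

(** Prepending a step multiplies by [step_poly s / 'X^d]; dropping the negative powers discards the
    starting points above level 0. *)
Lemma drop_step_walk_poly n :
  drop_poly d (step_poly * walk_poly n) = walk_poly n.+1.
Proof.
apply/polyP => h; rewrite coef_drop_poly coef_walk_poly /= natr_sum.
rewrite mulr_suml coef_sum [RHS]big_mkcond !big_seq; apply: eq_bigr => x xs.
rewrite coefXnM coef_walk_poly; have := max_down_ge xs.
case: ifP; case: ifP => //; try lia.
move=> h1 h2 h3; congr (walks_to_zero _ _ _)%:R; lia.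
Qed.

Lemma step_poly_coef0 : uniq s -> (0 < d)%N -> step_poly`_0 = 1.
Proof.
move=> us /max_down_mem ds; rewrite coef_sum (bigD1_seq _ ds us) /=.
rewrite addrN coefXn /= big_seq_cond big1 ?addr0 // =>
  x /andP[/max_down_ge xs nx].
by rewrite coefXn; case: eqP => //; move: nx; lia.
Qed.

End StepPolynomial.

(** * Small roots of the kernel equation *)

Section Roots.
Variables (R : numFieldType) (s : seq int).
Hypothesis uniq_s : uniq s.
Local Notation d := (max_down s).
Hypothesis d_gt0 : (0 < d)%N.
Local Notation Q := (step_poly s).
Local Notation T := (fps_X R ^+ d).
Local Notation X := (fps_X R).

Lemma fps_eqmM0 n m (f g : fps R) :
  fps_eqm n f 0 -> fps_eqm m g 0 -> fps_eqm (n + m) (f * g) 0.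
Proof.
move=> f0 g0 i lti; rewrite fcoefM big1 // => j _.
have [/f0 ->|lenj] := ltnP j n; first by rewrite mul0r.
by rewrite g0 ?mulr0 //; move: (ltn_ord j); lia.
Qed.

(** With [Z = X * Y] the equation becomes [Y ^+ d = Q(X * Y)], where [Y] has constant coefficient 1.
    [Phi] is a Newton step with the derivative frozen at [d]: in [f ^+ d - g ^+ d = (f - g) * S] the
    factor [S] is congruent to [d] modulo [X], and [Q(X * f)] already gains a factor [X]. *)
Lemma small_root_exists :
  exists2 Z : fps R, Z ^+ d = T * fps_eval Z Q & Z 1%N = 1.
Proof.
pose Phi (f : fps R) :=
  f - fps_const d%:R^-1 * (f ^+ d - fps_eval (X * f) Q).
have [||Y PhiY Y0] := @fps_contraction R 1 Phi.
- move=> [|//] _; rewrite /Phi fcoefB fcoefCM fcoefB expr1n mulr1.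
  suff -> : fps_eval X Q 0 = 1 by rewrite subrr mulr0 subr0.
  have -> : fps_eval X Q 0 = fps_eval 0 Q 0.
    by apply: (@fps_eqm_eval _ 1) => // -[|].
  rewrite (fps_evalE _ (leqnSn _)) fcoef_sum big_ord_recl step_poly_coef0 //.
  rewrite mulr1 rmorph1 big1 ?addr0 // => i _.
  by rewrite exprS mul0r mulr0.
- move=> n f g n_gt0 f1 g1 fg.
  pose S := \sum_(i < d) f ^+ (d.-1 - i) * g ^+ i.
  have PhiB : Phi f - Phi g = (f - g) * (1 - fps_const d%:R^-1 * S)
      + fps_const d%:R^-1 * (fps_eval (X * f) Q - fps_eval (X * g) Q).
    have fgX : f ^+ d - g ^+ d = (f - g) * S by rewrite subrXX.
    rewrite /Phi; have -> : f ^+ d = g ^+ d + (f - g) * S by rewrite -fgX; ring.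
    ring.
  have S1 : fps_eqm 1 (1 - fps_const d%:R^-1 * S) 0.
    move=> [|//] _; rewrite fcoefB fcoefCM fcoef_sum.
    rewrite (eq_bigr (fun=> 1)) => [|i _]; last first.
      have /(_ 0%N isT) -> := fps_eqmM (fps_eqmX (d.-1 - i) f1) (fps_eqmX i g1).
      by rewrite !expr1n mul1r.
    by rewrite sumr_const card_ord mulVf ?natd_neq0 // subrr.
  have fg0 : fps_eqm n (f - g) 0.
    by move=> i lti; rewrite fcoefB fg // subrr.
  move=> i lti; apply/eqP; rewrite -subr_eq0 -fcoefB PhiB fcoefD fcoefCM fcoefB.
  rewrite (fps_eqmM0 fg0 S1) ?addn1 // (fps_eqm_eval Q (fps_eqmXM fg)) //.
  by rewrite subrr mulr0 addr0.
exists (X * Y); last by rewrite fcoefXM Y0.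
have /eqP : fps_const d%:R^-1 * (Y ^+ d - fps_eval (X * Y) Q) = 0.
  by apply: (addrI (- Y)); rewrite addr0 -[in RHS]PhiY /Phi; ring.
rewrite mulf_eq0 fmorph_eq0 invr_eq0 (negPf (natd_neq0 _ d_gt0)) /= subr_eq0.
by move/eqP => YE; rewrite exprMn YE.
Qed.

(** At a root, [T * Q(y)] may be replaced by [y ^+ d]; splitting [Q * walk_poly s n] at degree [d]
    then writes each summand as a difference of consecutive terms
    [T ^+ n * y ^+ d * walk_poly s n (y)]. *)
Lemma root_telescope (y : fps R) N : y ^+ d = T * fps_eval y Q ->
  \sum_(n < N) T ^+ n.+1 * fps_eval y (take_poly d (Q * walk_poly s n))
    = y ^+ d - T ^+ N * (y ^+ d * fps_eval y (walk_poly s N)).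
Proof.
move=> yE; elim: N => [|N IHN].
  have -> : walk_poly s 0 = 1.
    by apply/polyP => h; rewrite coef_walk_poly coef1.
  by rewrite big_ord0 rmorph1 expr0 mul1r mulr1 subrr.
rewrite big_ord_recr IHN /=.
have /(congr1 (fps_eval y)) := poly_take_drop d (Q * walk_poly s N).
rewrite drop_step_walk_poly rmorphD !rmorphM rmorphXn /= fps_evalX.
move/(canRL (addrK _)) => ->; rewrite [T ^+ N.+1]exprS yE; ring.
Qed.

(* Negated coefficient of ['X^j] in the monic polynomial of degree [d] over the power
   series whose roots are the small roots. *)
Definition root_coef j : fps R :=
  T * fps_in_T d (fun n => ratr (take_poly d (Q * walk_poly s n))`_j).

(** The limit of [root_telescope], whose remainder is divisible by [T ^+ N]. *)
Lemma root_coefE (y : fps R) : y ^+ d = T * fps_eval y Q ->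
  y ^+ d = \sum_(j < d) root_coef j * y ^+ j.
Proof.
move=> yE; apply: fps_eqm_all => N i lti.
transitivity ((\sum_(n < N) T ^+ n.+1 *
    fps_eval y (take_poly d (Q * walk_poly s n))) i).
  by rewrite (root_telescope N yE) fcoefB (fps_eqm_TM d_gt0) // subr0.
under eq_bigr => n _ do rewrite (fps_evalE _ (size_take_poly _ _)) mulr_sumr.
rewrite exchange_big !fcoef_sum; apply: eq_bigr => j _.
under eq_bigr => n _ do rewrite mulrA.
rewrite -mulr_suml; apply: fps_eqmM lti => // {}i lti.
under eq_bigr => n _ do rewrite exprS -mulrA.
rewrite -mulr_sumr; apply: fps_eqmM lti => // {}i lti.
by rewrite (fps_in_T_eqm d_gt0 _ lti).
Qed.

Definition walk_series : fps R :=
  fps_in_T d (fun n => (walks_to_zero s n 0)%:R).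

Lemma root_coef0 : root_coef 0 = T * walk_series.
Proof.
congr (_ * _); apply/fpsP => n /=; case: ifP => // _.
rewrite coef_take_poly d_gt0 coefM big_ord1 step_poly_coef0 // mul1r.
by rewrite coef_walk_poly ratr_nat.
Qed.

Variable zeta : R.
Hypothesis prim_zeta : d.-primitive_root zeta.

Section RootFamily.
Variable Z : fps R.
Hypothesis ZE : Z ^+ d = T * fps_eval Z Q.
Hypothesis Z1 : Z 1%N = 1.

Definition small_root (k : 'I_d) : fps R := fps_scale (zeta ^+ k) Z.

(** Replacing [X] by [zeta ^+ k * X] fixes [T = X ^+ d], hence permutes the solutions of the
    equation. *)
Lemma small_rootE k : small_root k ^+ d = T * fps_eval (small_root k) Q.
Proof.
rewrite -rmorphXn ZE rmorphM /= fps_scale_eval; congr (_ * _).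
rewrite rmorphXn /=; have -> : fps_scale (zeta ^+ k) X = fps_const (zeta ^+ k)
  * X.
  apply/fpsP => n; rewrite fcoefCM /=.
  by case: eqP => [->|]; rewrite ?expr1 ?mulr0.
by rewrite exprMn -rmorphXn -exprM mulnC exprM (prim_expr_order prim_zeta)
  expr1n rmorph1 mul1r.
Qed.

Lemma small_root_inj : injective small_root.
Proof.
move=> i j /fpsP /(_ 1%N); rewrite /= !expr1 Z1 !mulr1 => /eqP.
rewrite (eq_prim_root_expr prim_zeta) !modn_small // => /eqP.
exact: val_inj.
Qed.

Lemma small_root_neq0 k : small_root k != 0.
Proof.
apply: contraTneq isT => /fpsP /(_ 1%N) /eqP.
rewrite /= expr1 Z1 mulr1 expf_eq0 (prim_root_eq0 prim_zeta).
by rewrite -[d == 0%N]negbK -lt0n d_gt0 andbF.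
Qed.

(** Both [A] and [P] are monic of degree [d], so their difference has degree below [d] and vanishes
    at [d] distinct roots. Comparing constant coefficients gives the formula. *)
Lemma walk_series_prod_roots :
  T * walk_series = fps_eval T (- (-1) ^+ d)%:P * \prod_k small_root k.
Proof.
pose A : {poly fps R} := 'X^d - \sum_(j < d) root_coef j *: 'X^j.
pose P : {poly fps R} := \prod_(y <- map small_root (enum 'I_d)) ('X - y%:P).
have szS : (size (\sum_(j < d) root_coef j *: 'X^j : {poly fps R})%R <= d)%N.
  apply: (leq_trans (size_sum _ _ _)); apply/bigmax_leqP => j _.
  by apply: leq_trans (size_scale_leq _ _) _; rewrite size_polyXn.
have szP : size P = d.+1 by rewrite size_prod_XsubC size_map -cardE card_ord.
have szAP : (size (A - P)%R <= d)%N.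
  rewrite /A addrAC; apply: (leq_trans (size_polyD _ _)).
  rewrite geq_max size_polyN szS andbT.
  apply/leq_sizeP => j; rewrite leq_eqVlt => /orP[/eqP <-|ltdj];
    rewrite coefB coefXn.
    have := monic_prod_XsubC (map small_root (enum 'I_d)) predT id.
    by rewrite eqxx => /monicP; rewrite lead_coefE szP /= => ->; rewrite subrr.
  by rewrite gtn_eqF // nth_default ?szP // subrr.
have AP : A - P = 0.
  apply: (@roots_geq_poly_eq0 _ _ (map small_root (enum 'I_d))).
  - apply/allP => y yr; rewrite /root hornerD hornerN.
    have /eqP -> : P.[y] == 0 by rewrite -/(root P y) root_prod_XsubC.
    case/mapP: yr => k _ ->; rewrite subr0 /A hornerD hornerN hornerXn
      horner_sum.
    rewrite subr_eq0.
    rewrite (root_coefE (small_rootE k)); apply/eqP; apply: eq_bigr => j _.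
    by rewrite hornerZ hornerXn.
  - by rewrite (map_inj_uniq small_root_inj) enum_uniq.
  - by rewrite size_map -cardE card_ord.
have /(congr1 (fun p => p.[0])) : A = P by apply/eqP; rewrite -subr_eq0 AP.
rewrite /A /P hornerD hornerN hornerXn horner_sum horner_prod.
rewrite expr0n -[d == 0%N]negbK -lt0n d_gt0 add0r.
rewrite (bigD1 (Ordinal d_gt0)) //= hornerZ hornerXn expr0 mulr1 big1 ?addr0.
  rewrite root_coef0 big_map big_enum /=.
  under eq_bigr => k _ do rewrite hornerXsubC sub0r.
  rewrite prodrN card_ord => /(canRL opprK) ->.
  by rewrite -mulNr fps_evalC rmorphN rmorphXn rmorphN rmorph1.
move=> j nej; rewrite hornerZ hornerXn expr0n -[(j : nat) == 0%N]negbK -lt0n.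
by rewrite lt0n -[0%N]/(val (Ordinal d_gt0)) (inj_eq val_inj) nej mulr0.
Qed.

(* Differentiating [z ^+ d = t Q(z)] gives [theta z * kappa = z ^+ d]. *)
Definition kappa k : fps R :=
  fps_eval (small_root k) (d%:R * 'X^(d.-1))
  - T * fps_eval (small_root k) Q^`().

Lemma kappaE k : fps_theta d (small_root k) * kappa k = small_root k ^+ d.
Proof.
set y := small_root k; have yE : y ^+ d = T * fps_eval y Q := small_rootE k.
have : fps_theta d (fps_eval y 'X^d) = fps_theta d (T * fps_eval y Q).
  by rewrite rmorphXn /= fps_evalX yE.
rewrite fps_thetaM // fps_theta_T // !fps_theta_eval // -yE derivXn.
rewrite -mulr_natl => /esym/(canRL (addrK _)) ->.
by rewrite /kappa -/y; ring.
Qed.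

(** Separability at the roots is read off [kappaE]: the product there is a power of a nonzero
    root. *)
Lemma kappa_neq0 k : kappa k != 0.
Proof.
apply: contraTneq isT => k0; have /eqP := kappaE k.
by rewrite k0 mulr0 eq_sym expf_eq0 (negPf (small_root_neq0 k)) andbF.
Qed.

(** A degree that serves every step set: the kernel has degree at most this, and a power of the root
    makes up the difference. *)
Definition root_bound := (d + max_step s)%N.

Lemma root_relation_list (l : seq ({poly rat} * nat)) (m : nat) :
  all (fun p : {poly rat} * nat => (size p.1 <= 3) && (p.2 < m))%N l ->
  exists2 rho : 'I_m -> {poly rat}, forall j, (size (rho j) <= 3)%N
    & forall y : fps R, \sum_(p <- l) fps_eval T p.1 * y ^+ p.2
        = \sum_j fps_eval T (rho j) * y ^+ j.
Proof.
move=> /allP lP; exists (fun j => \sum_(p <- l | p.2 == j :> nat) p.1).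
  move=> j; apply: (leq_trans (size_sum _ _ _)).
  by apply/bigmax_leqP_seq => p /lP/andP[].
move=> y; under [RHS]eq_bigr => j _ do rewrite rmorph_sum mulr_suml big_mkcond.
rewrite exchange_big !big_seq; apply: eq_bigr => p /lP /andP[_ ltm].
by rewrite -big_mkcond (big_pred1 (Ordinal ltm)).
Qed.

Lemma root_relation : 0 \notin s ->
  exists2 rho : 'I_root_bound -> {poly rat}, forall j, (size (rho j) <= 3)%N
    & forall k, fps_eval T 'X * small_root k ^+ root_bound
        = \sum_j fps_eval T (rho j) * small_root k ^+ j.
Proof.
move=> s0; set m := root_bound.
have evQ (y : fps R) : fps_eval y Q = \sum_(x <- s) y ^+ `|(d%:Z + x)%R|.
  by rewrite rmorph_sum; apply: eq_bigr => x _; rewrite rmorphXn /= fps_evalX.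
pose x0 := \big[Num.max/0]_(x <- s) x.
have x0_ge x : x \in s -> x <= x0.
  by rewrite /x0; elim: (s) => // x1 s' IHs; rewrite inE big_cons le_max =>
    /orP[/eqP ->|/IHs ->]; rewrite ?lexx ?orbT.
have x0_s : x0 != 0 -> x0 \in s.
  rewrite /x0; elim: (s) => [|x1 s' IHs]; first by rewrite big_nil eqxx.
  rewrite big_cons inE maxEle; case: ifP => _; last by rewrite eqxx.
  by move/IHs ->; rewrite orbT.
have x0_ge0 : 0 <= x0.
  by rewrite /x0; elim: (s) => [|x1 s' IHs]; rewrite ?big_nil ?big_cons //
    le_max IHs orbT.
(* In the first case all steps are negative and the kernel is monic of degree [d]. Multiplying
   [y ^+ d = T * Q(y)] by [T * y ^+ max_step s] yields the coefficients ['X^2] and exponents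
   [m + x < m]. *)
have [x00|nx0] := eqVneq x0 0.
  have [|rho szr rE] := @root_relation_list
      [seq ('X^2, `|(m%:Z + x)%R|%N) | x <- s] m.
    apply/allP => _ /mapP[x xs ->] /=; rewrite size_polyXn /=.
    have := x0_ge x xs; have := max_down_ge xs; rewrite /m /root_bound.
    have : x != 0 by apply: contraNneq s0 => <-.
    lia.
  exists rho => // k; rewrite -rE big_map fps_evalX; set y := small_root k.
  under [RHS]eq_bigr => x _ do rewrite rmorphXn /= fps_evalX.
  rewrite -mulr_sumr expr2 -mulrA; congr (_ * _).
  rewrite [y ^+ m]exprD [y ^+ d]small_rootE evQ -mulrA mulr_suml.
  congr (_ * _); rewrite !big_seq.
  apply: eq_bigr => x xs; rewrite -exprD; congr (_ ^+ _).
  by have := max_down_ge xs; rewrite /m /root_bound; lia.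
(* Now the largest step [x0] is positive and [T * y ^+ (d + x0)] is the leading term; multiplying by
   [y ^+ (max_step s - x0)] raises it to degree [m]. *)
have x0s := x0_s nx0.
have [|rho szr rE] := @root_relation_list ((1, `|(m%:Z - x0)%R|%N) ::
    [seq (- 'X, `|(m%:Z + x - x0)%R|%N) | x <- rem x0 s]) m.
  have x0m := leq_max_step x0s.
  apply/allP => p; rewrite inE => /orP[/eqP ->|/mapP[x xs ->]] /=.
    by rewrite size_poly1 /m /root_bound; lia.
  rewrite size_polyN size_polyX /=; move: xs; rewrite mem_rem_uniq // =>
    /andP[/= nx xs].
  by have := x0_ge x xs; have := max_down_ge xs; rewrite /m /root_bound; lia.
exists rho => // k; rewrite -rE big_cons big_map fps_evalX /= rmorph1 mul1r.
set y := small_root k.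
under eq_bigr => x _ do rewrite rmorphN /= fps_evalX mulNr.
rewrite sumrN -mulr_sumr; have x0m := leq_max_step x0s.
have -> : y ^+ `|(m%:Z - x0)%R|
    = T * (fps_eval y Q * y ^+ `|((max_step s)%:Z - x0)%R|).
  rewrite mulrA -small_rootE -exprD; congr (_ ^+ _).
  by rewrite /m /root_bound; lia.
rewrite evQ (perm_big _ (perm_to_rem x0s)) big_cons /= mulrDl mulr_suml -mulrBr.
congr (_ * _); rewrite -exprD -addrA -sumrB big_seq big1 ?addr0 => [|x].
  by congr (_ ^+ _); rewrite /m /root_bound; lia.
rewrite mem_rem_uniq // => /andP[/= nx xs]; apply/eqP; rewrite -exprD subr_eq0.
apply/eqP; congr (_ ^+ _).
by have := x0_ge x xs; have := max_down_ge xs; rewrite /m /root_bound; lia.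
Qed.

End RootFamily.
End Roots.

(** * The differential equation of the walk series *)

Section ThetaInT.
Variables (R : numFieldType) (d : nat).
Hypothesis d_gt0 : (0 < d)%N.
Local Notation T := (fps_X R ^+ d).

Lemma fps_theta_in_T (b : nat -> R) :
  fps_theta d (fps_in_T d b) = fps_in_T d (fun n => n%:R * b n).
Proof.
apply/fpsP => n /=; case: ifP => [/dvdnP[k ->]|]; last by rewrite mulr0.
by rewrite mulnK // natrM mulfK // natd_neq0.
Qed.

Lemma iter_fps_theta_in_T (b : nat -> R) j :
  iter j (fps_theta d) (fps_in_T d b) = fps_in_T d (fun n => n%:R ^+ j * b n).
Proof.
elim: j => [|j IHj] /=; first by apply/fpsP => n /=; rewrite expr0 mul1r.
rewrite IHj fps_theta_in_T; apply/fpsP => n /=; case: ifP => // _.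
by rewrite exprS mulrA.
Qed.

Lemma fps_eval_T_in_T (p : {poly rat}) (b : nat -> R) :
  fps_eval T p * fps_in_T d b
    = fps_in_T d (fun n => \sum_(i < n.+1) ratr p`_i * b (n - i)%N).
Proof.
apply/fpsP => n; rewrite fps_eval_TM // /=; case: ifP => [/dvdnP[k]|ndvd].
  rewrite mulnC => ->; rewrite mulKn //.
  rewrite (big_ord_widen (d * k).+1 (fun i => ratr p`_i * b (k - i)%N));
    last first.
    by rewrite ltnS leq_pmull.
  apply: eq_big => [i|i]; rewrite leq_pmul2l // => leik.
  by rewrite -mulnBr dvdn_mulr // mulKn.
rewrite big1 // => i le_in; rewrite ifN ?mulr0 //.
by apply: contraFN ndvd => dvd; rewrite -(subnK le_in) dvdn_addl // dvdn_mulr.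
Qed.

End ThetaInT.

(** The coefficient of [t ^ n] in [\sum_j w j * theta^j A], for [A] the generating function of
    [a]. *)
Definition ode_coef (a : nat -> nat) (R : nat) (w : 'I_R ->
  {poly rat}) (n : nat) : rat :=
  \sum_j \sum_(i < n.+1) (w j)`_i * (n - i)%:R ^+ j * (a (n - i)%N)%:R.

(** The gauge of [kappa k]: a polynomial of size at most [root_bound s] in a root has twice that
    gauge, and the factor [T] adds 1. *)
Definition step_gauge s := (root_bound s).*2.+1.

Section WalkODE.
Variable s : seq int.
Hypotheses (uniq_s : uniq s) (s_neq0 : 0 \notin s).
Local Notation d := (max_down s).
Local Notation m := (root_bound s).
Hypothesis d_gt0 : (0 < d)%N.
Local Notation a := (fun n => walks_to_zero s n 0).

Lemma size_step_poly : (size (step_poly s) <= m.+1)%N.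
Proof.
apply: (leq_trans (size_sum _ _ _)); apply/bigmax_leqP_seq => x xs _.
by rewrite size_polyXn ltnS; have := leq_max_step xs; rewrite /root_bound; lia.
Qed.

Variables (C : numFieldType) (zeta : C).
Hypothesis prim_zeta : d.-primitive_root zeta.
Local Notation T := (fps_X C ^+ d).
Local Notation iota := (fps_eval T).
Local Notation E := (walk_series C s).

Lemma walk_odeE R (w : 'I_R -> {poly rat}) :
  \sum_j iota (w j) * iter j (fps_theta d) E
    = fps_in_T d (fun n => ratr (ode_coef a w n)).
Proof.
under eq_bigr => j _ do rewrite iter_fps_theta_in_T // fps_eval_T_in_T //.
apply/fpsP => n; rewrite fcoef_sum /=; case: ifP => _; last by rewrite big1.
rewrite rmorph_sum; apply: eq_bigr => j _; rewrite rmorph_sum.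
by apply: eq_bigr => i _; rewrite !rmorphM rmorphXn /= !ratr_nat mulrA.
Qed.

Section WithRoot.
Variable Z : fps C.
Local Notation z := (@small_root C s zeta Z).

Lemma m_gt0 : (0 < m)%N. Proof. by rewrite /root_bound addn_gt0 d_gt0. Qed.

Lemma iotaX_neq0 : iota 'X != 0.
Proof. by apply: fps_eval_T_neq0; rewrite // polyX_eq0. Qed.

Section WithRelation.
Variable rho : 'I_m -> {poly rat}.
Hypothesis size_rho : forall j, (size (rho j) <= 3)%N.
Hypothesis z_rho :
  forall k, iota 'X * z k ^+ m = \sum_j iota (rho j) * z k ^+ j.
Local Notation filt := (filt iota (@monomial _ d m z)).

Lemma filt_eval_root k (p : {poly rat}) N : (size p <= N)%N ->
  filt N.*2 (fps_eval (z k) p).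
Proof.
move=> szp; rewrite (fps_evalE _ szp); apply: filt_sum => i _.
rewrite -(fps_evalC T); apply: filt_scaleC.
have := filt_mulcost m_gt0 (mulcostX i (mulcost_z size_rho z_rho k)).
by apply: filt_leq; have := ltn_ord i; lia.
Qed.

Lemma filt_kappa k : filt (step_gauge s) (@kappa C s zeta Z k).
Proof.
rewrite /step_gauge -addn1; apply: filtB.
  apply: filt_leq (leq_addr _ _) _; apply: filt_eval_root.
  rewrite mulr_natl -scaler_nat; apply: leq_trans (size_scale_leq _ _) _.
  by rewrite size_polyXn prednK // /root_bound leq_addr.
rewrite -[X in filt _ (X * _)]fps_evalX; apply: filt_scale.
  by rewrite size_polyX.
apply: filt_eval_root; apply: leq_trans (size_poly _ _) _.
by rewrite -subn1 leq_subLR add1n size_step_poly.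
Qed.

End WithRelation.
End WithRoot.

Lemma theta_eval_T p : fps_theta d (iota p) = iota ('X * p^`()).
Proof.
by rewrite fps_theta_eval // fps_theta_T // rmorphM /= fps_evalX mulrC.
Qed.

Lemma walk_ode_exists_prim : exists (R : nat) (w : 'I_R -> {poly rat}),
  (exists j, w j != 0) /\ forall n, ode_coef a w n = 0.
Proof.
have [Z ZE Z1] := small_root_exists C uniq_s d_gt0.
have [rho szr rE] := root_relation uniq_s d_gt0 prim_zeta ZE s_neq0.
have tE := walk_series_prod_roots uniq_s d_gt0 prim_zeta ZE Z1.
rewrite -{1}[T]fps_evalX in tE.
have [q [nzq qE]] := ode_exists iotaX_neq0 m_gt0 szr rE (fps_thetaM d_gt0)
  theta_eval_T (filt_kappa szr rE) (kappa_neq0 d_gt0 prim_zeta ZE Z1)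
  (kappaE d_gt0 prim_zeta ZE) tE (@fps_eval_T_neq0 C d d_gt0).
exists _, q; split=> // n; move: qE; rewrite walk_odeE => /fpsP /(_ (d * n)%N).
by rewrite /= dvdn_mulr // mulKn // => /eqP; rewrite fmorph_eq0 => /eqP.
Qed.

(** If the series [H] were nonzero it would divide some nonzero [q] in [t] of size at most
    [check_gauge]; but [H], hence [q], vanishes to at least that order in [t]. *)
Lemma walk_ode_check_prim R L (w : 'I_R -> {poly rat}) :
  (forall j, (size (w j) <= L.+1)%N) ->
  (forall n, (L <= n < check_gauge d m (step_gauge s) R L)%N ->
     ode_coef a w n = 0) ->
  forall n, (L <= n)%N -> ode_coef a w n = 0.
Proof.
move=> szw w_check.
have [Z ZE Z1] := small_root_exists C uniq_s d_gt0.
have [rho szr rE] := root_relation uniq_s d_gt0 prim_zeta ZE s_neq0.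
have tE := walk_series_prod_roots uniq_s d_gt0 prim_zeta ZE Z1.
rewrite -{1}[T]fps_evalX in tE.
(* Subtracting [w0] cancels the coefficients of index below [L], so that the check starts at [L]. *)
pose w0 : {poly rat} := \poly_(i < L) ode_coef a w i.
have szw0 : (size w0 <= L.+1)%N by rewrite leqW // size_poly.
pose H := \sum_j iota (w j) * iter j (fps_theta d) E - iota w0.
have HE n : H (d * n)%N = ratr (ode_coef a w n - w0`_n).
  rewrite fcoefB walk_odeE fps_eval_T // rmorphB /=.
  by rewrite dvdn_mulr // mulKn.
have H_ndvd n : ~~ (d %| n)%N -> H n = 0.
  move=> nd; rewrite fcoefB walk_odeE /= (negPf nd) sub0r.
  rewrite -[iota w0]mulr1 fps_eval_TM // big1 ?oppr0 // => i le_in /=.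
  rewrite mulrb ifN ?mulr0 // subn_eq0 -ltnNge ltn_neqAle le_in andbT.
  by apply: contraNneq nd => <-; apply: dvdn_mulr.
suff H0 : H = 0.
  move=> n leLn; move/fpsP: H0 => /(_ (d * n)%N);
    rewrite HE coef_poly ltnNge leLn.
  by rewrite subr0 => /eqP; rewrite fmorph_eq0 => /eqP.
apply: contrapT => /eqP nzH.
have [q [g [nzq szq gE]]] := ode_check iotaX_neq0 m_gt0 szr rE (fps_thetaM
  d_gt0)
  theta_eval_T (filt_kappa szr rE) (kappa_neq0 d_gt0 prim_zeta ZE Z1)
  (kappaE d_gt0 prim_zeta ZE) tE (@fps_eval_T_neq0 C d d_gt0) szw szw0 nzH.
have {}gE : iota q = H * g by rewrite gE.
case/eqP: nzq; apply: (@fps_eval_T_eq0 C d d_gt0 _ _ szq) => i lti; rewrite gE.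
rewrite -(mul0r g).
apply: fps_eqmM lti => // {}i lti.
have [/dvdnP[k]|/H_ndvd //] := boolP (d %| i)%N; rewrite mulnC => ik.
move: lti; rewrite ik ltn_pmul2l // HE coef_poly => ltk.
case: ltnP => [_|leLk]; first by rewrite subrr rmorph0.
by rewrite w_check ?leLk // subr0 rmorph0.
Qed.

End WalkODE.

Section WalkODEAlgC.
Variable s : seq int.
Hypotheses (uniq_s : uniq s) (s_neq0 : 0 \notin s).
Hypothesis d_gt0 : (0 < max_down s)%N.
Local Notation a := (fun n => walks_to_zero s n 0).

Lemma walk_ode_exists : exists (R : nat) (w : 'I_R -> {poly rat}),
  (exists j, w j != 0) /\ forall n, ode_coef a w n = 0.
Proof.
have [zeta prim_zeta] := C_prim_root_exists d_gt0.
exact: walk_ode_exists_prim prim_zeta.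
Qed.

Lemma walk_ode_check R L (w : 'I_R -> {poly rat}) :
  (forall j, (size (w j) <= L.+1)%N) ->
  (forall n,
     (L <= n < check_gauge (max_down s) (root_bound s) (step_gauge s) R L)%N ->
     ode_coef a w n = 0) ->
  forall n, (L <= n)%N -> ode_coef a w n = 0.
Proof.
have [zeta prim_zeta] := C_prim_root_exists d_gt0.
exact: (walk_ode_check_prim uniq_s s_neq0 d_gt0 prim_zeta).
Qed.

End WalkODEAlgC.

(** * Recursive functions on encoded data *)

Section RecN.
Implicit Types n m : nat.

(** Concerns total functions; unbounded minimisation enters only in the final program. *)
Definition recn n (F : n.-tuple nat -> nat) :=
  exists f : recfun n, forall v, computes f v (F v).

Lemma eq_recn n (F G : n.-tuple nat -> nat) : F =1 G -> recn F -> recn G.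
Proof. by move=> FG [f fF]; exists f => v; rewrite -FG. Qed.

Lemma recn_proj n (i : 'I_n) : recn (fun v => tnth v i).
Proof. by exists (RProj i). Qed.

Lemma recn_comp m n (F : m.-tuple nat -> nat) (G : 'I_m -> n.-tuple nat ->
  nat) :
  recn F -> (forall i, recn (G i)) -> recn (fun v => F [tuple G i v | i < m]).
Proof.
move=> [f fF] /choice [g gG]; exists (RComp f g) => v /=.
by exists [tuple G i v | i < m]; split=> // i; rewrite tnth_mktuple.
Qed.

Definition rec1 (F : nat -> nat) := recn (fun v : 1.-tuple nat =>
  F (tnth v ord0)).
Definition rec2 (F : nat -> nat -> nat) :=
  recn (fun v : 2.-tuple nat => F (tnth v ord0) (tnth v (inord 1))).
Definition rec3 (F : nat -> nat -> nat -> nat) :=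
  recn (fun v : 3.-tuple nat => F (tnth v ord0) (tnth v (inord 1)) (tnth v
    (inord 2))).

Lemma recn_zero n : recn (fun _ : n.-tuple nat => 0%N).
Proof.
have rz : recn (fun _ : 0.-tuple nat => 0%N) by exists RZero.
by apply: (recn_comp (G := fun i _ => 0%N)) rz _ => -[].
Qed.

Lemma rec1_succ : rec1 S.
Proof. by exists RSucc => v /=; rewrite /thead. Qed.

Lemma recn_comp1 n F (G : n.-tuple nat -> nat) :
  rec1 F -> recn G -> recn (fun v => F (G v)).
Proof.
move=> rF rG; apply: eq_recn (recn_comp rF (fun=> rG)) => v /=.
by rewrite tnth_mktuple.
Qed.

Lemma recn_comp2 n F (G H : n.-tuple nat -> nat) :
  rec2 F -> recn G -> recn H -> recn (fun v => F (G v) (H v)).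
Proof.
move=> rF rG rH.
apply: eq_recn (recn_comp (G := fun i => if i == ord0 then G else H) rF _) =>
  [v|i].
  by rewrite !tnth_mktuple eqxx -val_eqE /= inordK.
by case: ifP.
Qed.

Lemma recn_const n c : recn (fun _ : n.-tuple nat => c).
Proof.
elim: c => [|c IHc]; first exact: recn_zero.
exact: recn_comp1 rec1_succ IHc.
Qed.

Lemma rec2_prim F G : rec1 F -> rec3 G ->
  rec2 (fun n x => nat_rect (fun=> nat) (F x) (fun k r => G k r x) n).
Proof.
move=> [f fF] [g gG]; exists (RPrim f g) => v /=.
exists (nat_rect (fun=> nat) (F (tnth v (inord 1)))
  (fun k r => G k r (tnth v (inord 1)))).
have thv : tnth [tuple of behead v] ord0 = tnth v (inord 1).
  by rewrite !(tnth_nth 0%N) /= nth_behead inordK.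
split=> [|k _|] //=; first by have := fF [tuple of behead v]; rewrite thv.
have := gG [tuple of k :: nat_rect (fun=> nat) (F (tnth v (inord 1)))
  (fun k r => G k r (tnth v (inord 1))) k :: behead v].
by rewrite !(tnth_nth 0%N) /= !inordK //= nth_behead.
Qed.

Lemma rec1_id : rec1 id. Proof. exact: recn_proj. Qed.

Lemma rec1_comp F G : rec1 F -> rec1 G -> rec1 (fun x => F (G x)).
Proof. exact: recn_comp1. Qed.

Lemma rec1_comp2 F G H : rec2 F -> rec1 G -> rec1 H -> rec1 (fun x =>
  F (G x) (H x)).
Proof. exact: recn_comp2. Qed.

Lemma rec1_prim K F G : rec1 K -> rec1 F -> rec3 G ->
  rec1 (fun x => nat_rect (fun=> nat) (F x) (fun k r => G k r x) (K x)).
Proof. by move=> rK rF rG; apply: rec1_comp2 (rec2_prim rF rG) rK rec1_id. Qed.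

Lemma rec3_1 : rec3 (fun k _ _ => k). Proof. exact: recn_proj. Qed.
Lemma rec3_2 : rec3 (fun _ r _ => r). Proof. exact: recn_proj. Qed.
Lemma rec3_3 : rec3 (fun _ _ x => x). Proof. exact: recn_proj. Qed.

Lemma rec3_const c : rec3 (fun _ _ _ => c). Proof. exact: recn_const. Qed.
Lemma rec3_comp1 F G : rec1 F -> rec3 G -> rec3 (fun k r x => F (G k r x)).
Proof. exact: recn_comp1. Qed.
Lemma rec3_comp2 F G H : rec2 F -> rec3 G -> rec3 H ->
  rec3 (fun k r x => F (G k r x) (H k r x)).
Proof. exact: recn_comp2. Qed.
Lemma rec1_const c : rec1 (fun _ => c). Proof. exact: recn_const. Qed.
Lemma rec2_1 : rec2 (fun x _ => x). Proof. exact: recn_proj. Qed.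
Lemma rec2_2 : rec2 (fun _ y => y). Proof. exact: recn_proj. Qed.
Lemma rec2_const c : rec2 (fun _ _ => c). Proof. exact: recn_const. Qed.
Lemma rec2_comp1 F G : rec1 F -> rec2 G -> rec2 (fun x y => F (G x y)).
Proof. exact: recn_comp1. Qed.
Lemma rec2_comp2 F G H : rec2 F -> rec2 G -> rec2 H ->
  rec2 (fun x y => F (G x y) (H x y)).
Proof. exact: recn_comp2. Qed.

Lemma eq_rec1 F G : F =1 G -> rec1 F -> rec1 G.
Proof. by move=> FG; apply: eq_recn => v. Qed.
Lemma eq_rec2 F G : F =2 G -> rec2 F -> rec2 G.
Proof. by move=> FG; apply: eq_recn => v. Qed.

Lemma rec2_swap F : rec2 F -> rec2 (fun x y => F y x).
Proof. by move=> rF; apply: (rec2_comp2 rF rec2_2 rec2_1). Qed.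

Lemma rec2_add : rec2 addn.
Proof.
apply: eq_rec2 (rec2_prim rec1_id (rec3_comp1 rec1_succ rec3_2)) => n x.
by elim: n => //= n ->.
Qed.

Lemma rec2_mul : rec2 muln.
Proof.
apply: eq_rec2 (rec2_prim (rec1_const 0) (rec3_comp2 rec2_add rec3_3 rec3_2))
  => n x.
by elim: n => //= n ->; rewrite mulSn.
Qed.

Lemma rec2_exp : rec2 expn.
Proof.
apply: (rec2_swap (F := fun n x => x ^ n)%N).
apply: eq_rec2 (rec2_prim (rec1_const 1) (rec3_comp2 rec2_mul rec3_3 rec3_2))
  => n x.
by elim: n => //= n ->; rewrite expnS.
Qed.

Lemma rec1_pred : rec1 predn.
Proof.
by apply: eq_rec1 (rec1_prim rec1_id (rec1_const 0) rec3_1) => -[].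
Qed.

Lemma rec2_sub : rec2 subn.
Proof.
apply: (rec2_swap (F := fun n x => x - n)%N).
apply: eq_rec2 (rec2_prim rec1_id (rec3_comp1 rec1_pred rec3_2)) => n x /=.
by elim: n => [|n IHn] /=; rewrite ?subn0 // subnS -IHn.
Qed.

Lemma rec1_eq0 : rec1 (fun x => x == 0%N).
Proof.
by apply: eq_rec1 (rec1_prim rec1_id (rec1_const 1) (rec3_const 0)) => -[].
Qed.

Lemma rec2_leq : rec2 (fun x y => x <= y)%N.
Proof. exact: (rec2_comp1 rec1_eq0 rec2_sub). Qed.

Lemma rec2_eq : rec2 (fun x y => x == y).
Proof.
apply: eq_rec2 (rec2_comp2 rec2_mul rec2_leq (rec2_swap rec2_leq)) => x y.
by rewrite mulnb -eqn_leq.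
Qed.

Lemma rec1_odd : rec1 odd.
Proof.
apply: eq_rec1 (rec1_prim rec1_id (rec1_const 0) (rec3_comp1 rec1_eq0 rec3_2))
  => x.
by elim: x => //= x ->; case: (odd x).
Qed.

Lemma rec1_double : rec1 double.
Proof.
by apply: eq_rec1 (rec1_comp2 rec2_add rec1_id rec1_id) => x; rewrite addnn.
Qed.

Lemma rec2_max : rec2 maxn.
Proof.
apply: eq_rec2 (rec2_comp2 rec2_add rec2_1 (rec2_comp2 rec2_sub rec2_2
  rec2_1)) => x y.
by rewrite maxnE.
Qed.

Lemma rec1_half : rec1 half.
Proof.
apply: eq_rec1 (rec1_prim rec1_id (rec1_const 0)
  (rec3_comp2 rec2_add (rec3_comp1 rec1_odd rec3_1) rec3_2)) => x.
by elim: x => //= x ->; rewrite uphalf_half.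
Qed.

Lemma rec2_div2n : rec2 (fun k x => x %/ 2 ^ k)%N.
Proof.
apply: eq_rec2 (rec2_prim rec1_id (rec3_comp1 rec1_half rec3_2)) => k x.
elim: k => [|k IHk] /=; first by rewrite divn1.
by rewrite IHk expnSr divnMA divn2.
Qed.

Lemma rec1_if C A B : rec1 C -> rec1 A -> rec1 B ->
  rec1 (fun x => if C x == 0%N then A x else B x).
Proof.
move=> rC rA rB; have rC0 := rec1_comp rec1_eq0 rC.
apply: eq_rec1 (rec1_comp2 rec2_add (rec1_comp2 rec2_mul rC0 rA)
  (rec1_comp2 rec2_mul (rec1_comp rec1_eq0 rC0) rB)) => x.
by case: eqP; rewrite /= ?mul1n ?mul0n ?addn0.
Qed.

(** This is how [CodeSeq.code] encodes a list with head [a] and tail code [b], so pairs and nonempty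
    lists share one encoding, and 0 is left for the empty list. *)
Definition pairn a b := (2 ^ a * b.*2.+1)%N.

Lemma rec2_pair : rec2 pairn.
Proof.
apply: eq_rec2 (rec2_comp2 rec2_mul
  (rec2_comp2 rec2_exp (rec2_const 2) rec2_1)
  (rec2_comp1 rec1_succ (rec2_comp2 rec2_add rec2_2 rec2_2))) => a b.
by rewrite /pairn addnn.
Qed.

(** The 2-adic valuation for [x > 0], counted as the number of powers [2 ^ k.+1] dividing [x]. *)
Definition fstn x := (\sum_(k < x) (2 ^ k.+1 * (x %/ 2 ^ k.+1) == x))%N.
Definition sndn x := (x %/ 2 ^ fstn x)./2.

Lemma rec1_fst : rec1 fstn.
Proof.
have rS : rec3 (fun k _ _ => k.+1) := rec3_comp1 rec1_succ rec3_1.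
apply: eq_rec1 (rec1_prim rec1_id (rec1_const 0)
  (rec3_comp2 rec2_add rec3_2 (rec3_comp2 rec2_eq (rec3_comp2 rec2_mul
     (rec3_comp2 rec2_exp (rec3_const 2) rS)
     (rec3_comp2 rec2_div2n rS rec3_3)) rec3_3))) => x.
suff sE n : nat_rect (fun=> nat) 0%N
    (fun k r => r + (2 ^ k.+1 * (x %/ 2 ^ k.+1) == x))%N n
    = (\sum_(k < n) (2 ^ k.+1 * (x %/ 2 ^ k.+1) == x))%N by apply: sE.
elim: n => [|k IHk] /=; first by rewrite big_ord0.
by rewrite IHk big_ord_recr.
Qed.

Lemma rec1_snd : rec1 sndn.
Proof.
exact: rec1_comp rec1_half (rec1_comp2 rec2_div2n rec1_fst rec1_id).
Qed.

Lemma pairn_gt0 a b : (0 < pairn a b)%N.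
Proof. by rewrite muln_gt0 expn_gt0. Qed.

Lemma fstn_pair a b : fstn (pairn a b) = a.
Proof.
have lna : logn 2 (pairn a b) = a.
  rewrite lognM ?expn_gt0 // pfactorK // logn_coprime ?addn0 //.
  by rewrite coprime2n /= odd_double.
have le_ax : (a <= pairn a b)%N.
  by apply: leq_trans (leq_pmulr _ _) => //; apply/ltnW/ltn_expl.
rewrite /fstn -[RHS](card_ord a) -sum1_card (big_ord_widen _ (fun=> 1%N) le_ax).
rewrite [RHS]big_mkcond; apply: eq_bigr => k _.
rewrite mulnC -dvdn_eq pfactor_dvdn ?pairn_gt0 // lna.
by case: (k < a)%N.
Qed.

Lemma sndn_pair a b : sndn (pairn a b) = b.
Proof. by rewrite /sndn fstn_pair mulKn ?expn_gt0 //= uphalf_double. Qed.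

End RecN.

(** * Computable functions between encoded types *)

Class Enc (T : Type) := enc : T -> nat.
#[global] Instance enc_nat : Enc nat := id.
#[global] Instance enc_int : Enc int := code_int.
#[global] Instance enc_prod T U {eT : Enc T} {eU : Enc U} : Enc (T * U) :=
  fun p => pairn (enc p.1) (enc p.2).
#[global] Instance enc_seq T {eT : Enc T} : Enc (seq T) :=
  fun s => CodeSeq.code (map enc s).

Definition computable {T U} {eT : Enc T} {eU : Enc U} (F : T -> U) :=
  exists2 G, rec1 G & forall x, G (enc x) = enc (F x).

Section Computable.
Context {T U V : Type} {eT : Enc T} {eU : Enc U} {eV : Enc V}.

Lemma eq_computable (F G : T -> U) : F =1 G -> computable F -> computable G.
Proof. by move=> FG [f rf fF]; exists f => // x; rewrite fF FG. Qed.

Lemma computable_id : computable (fun x : T => x).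
Proof. by exists id => //; apply: rec1_id. Qed.

Lemma computable_comp (F : U -> V) (G : T -> U) :
  computable F -> computable G -> computable (fun x => F (G x)).
Proof.
move=> [f rf fF] [g rg gG]; exists (fun x => f (g x)) => [|x].
  exact: rec1_comp.
by rewrite gG fF.
Qed.

Lemma computable_const (c : U) : computable (fun _ : T => c).
Proof. by exists (fun=> enc c) => //; apply: recn_const. Qed.

Lemma computable_pair (F : T -> U) (G : T -> V) :
  computable F -> computable G -> computable (fun x => (F x, G x)).
Proof.
move=> [f rf fF] [g rg gG]; exists (fun x => pairn (f x) (g x)) => [|x].
  exact: rec1_comp2 rec2_pair rf rg.
by rewrite gG fF.
Qed.

Lemma computable_fst (F : T -> U * V) : computable F -> computable (fun x =>
  (F x).1).
Proof.
move=> [f rf fF]; exists (fun x => fstn (f x)) => [|x].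
  exact: rec1_comp rec1_fst rf.
by rewrite fF fstn_pair.
Qed.

Lemma computable_snd (F : T -> U * V) : computable F -> computable (fun x =>
  (F x).2).
Proof.
move=> [f rf fF]; exists (fun x => sndn (f x)) => [|x].
  exact: rec1_comp rec1_snd rf.
by rewrite fF sndn_pair.
Qed.

Lemma computable_op1 (H : nat -> nat) (F : T -> nat) :
  rec1 H -> computable F -> computable (fun x => H (F x)).
Proof.
move=> rH [f rf fF]; exists (fun x => H (f x)) => [|x].
  exact: rec1_comp.
by rewrite fF.
Qed.

Lemma computable_op2 (H : nat -> nat -> nat) (F G : T -> nat) :
  rec2 H -> computable F -> computable G -> computable (fun x => H (F x) (G x)).
Proof.
move=> rH [f rf fF] [g rg gG]; exists (fun x => H (f x) (g x)) => [|x].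
  exact: rec1_comp2.
by rewrite gG fF.
Qed.

Lemma computable_if0 (C : T -> nat) (A B : T -> U) :
  computable C -> computable A -> computable B ->
  computable (fun x => if C x == 0%N then A x else B x).
Proof.
move=> [c rc cC] [a ra aA] [b rb bB].
exists (fun x => if c x == 0%N then a x else b x) => [|x].
  exact: rec1_if.
by rewrite cC aA bB; case: (C x).
Qed.

Lemma computable_if (C : T -> bool) (A B : T -> U) :
  computable (fun x => nat_of_bool (C x)) -> computable A -> computable B ->
  computable (fun x => if C x then A x else B x).
Proof.
move=> cC cA cB; apply: eq_computable (computable_if0 cC cB cA) => x.
by case: (C x).
Qed.

Lemma computable_natrec (K : T -> nat) (A : T -> U) (G : T -> nat -> U -> U) :
  computable K -> computable A ->
  computable (fun p : T * nat * U => G p.1.1 p.1.2 p.2) ->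
  computable (fun x => nat_rect (fun=> U) (A x) (G x) (K x)).
Proof.
move=> [k rk kK] [a ra aA] [g rg gG].
exists (fun x => nat_rect (fun=> nat) (a x)
  (fun i r => g (pairn (pairn x i) r)) (k x)) => [|x].
  apply: (rec1_prim (G := fun i r x => g (pairn (pairn x i) r))) => //.
  exact: (rec3_comp1 rg (rec3_comp2 rec2_pair
    (rec3_comp2 rec2_pair rec3_3 rec3_1) rec3_2)).
rewrite kK; elim: (K x) => [|i IHi] /=; first exact: aA.
by rewrite IHi; apply: (gG (x, i, _)).
Qed.

Lemma computable_cons (F : T -> U) (S : T -> seq U) :
  computable F -> computable S -> computable (fun x => F x :: S x).
Proof.
move=> [f rf fF] [g rg gG]; exists (fun x => pairn (f x) (g x)) => [|x].
  exact: rec1_comp2 rec2_pair rf rg.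
by rewrite gG fF.
Qed.

(** A nonempty list has the same code as the pair of its head and tail, so its code is handed to [B]
    unchanged. *)
Lemma computable_seqcase (S : T -> seq U) (A : T -> V) (B : T -> U -> seq U ->
  V) :
  computable S -> computable A ->
  computable (fun p : T * (U * seq U) => B p.1 p.2.1 p.2.2) ->
  computable (fun x => if S x is a :: l then B x a l else A x).
Proof.
move=> [f rf fS] [a ra aA] [b rb bB].
exists (fun x => if f x == 0%N then a x else b (pairn x (f x))) => [|x].
  apply: rec1_if => //; apply: rec1_comp rb _.
  exact: rec1_comp2 rec2_pair rec1_id rf.
rewrite fS; case: (S x) => [|u l]; first exact: aA.
by rewrite ifN; [apply: (bB (x, (u, l))) | rewrite -lt0n pairn_gt0].
Qed.

Lemma computable_intcase (I : T -> int) (A B : T -> nat -> V) :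
  computable I -> computable (fun p : T * nat => A p.1 p.2) ->
  computable (fun p : T * nat => B p.1 p.2) ->
  computable (fun x => match I x with Posz n => A x n | Negz n => B x n end).
Proof.
move=> [f rf fI] [a ra aA] [b rb bB].
exists (fun x => if odd (f x) == 0%N :> nat then a (pairn x (f x)./2)
  else b (pairn x (f x)./2)) => [|x].
  have rp : rec1 (fun x => pairn x (f x)./2).
    exact: rec1_comp2 rec2_pair rec1_id (rec1_comp rec1_half rf).
  apply: rec1_if; [exact: rec1_comp rec1_odd rf | exact: rec1_comp ra rp | ].
  exact: rec1_comp rb rp.
rewrite fI; case: (I x) => n.
  by rewrite /enc /= odd_double doubleK; apply: (aA (x, n)).
by rewrite /enc /= odd_double uphalf_double; apply: (bB (x, n)).
Qed.

End Computable.

Ltac comp_hook := fail.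

(** Directed by the head symbol of the body; goals it does not recognise fall to hypotheses or to
    [comp_hook], and otherwise remain. *)
Ltac comp := cbn beta; lazymatch goal with
  | |- computable (fun _ => ?c) => exact (computable_const c)
  | |- computable (fun x => x) => refine computable_id
  | |- computable fst => refine (computable_fst computable_id)
  | |- computable snd => refine (computable_snd computable_id)
  | |- computable (fun x => fst (@?F x)) => refine (computable_fst _); comp
  | |- computable (fun x => snd (@?F x)) => refine (computable_snd _); comp
  | |- computable (fun x => (@?F x, @?G x)) => refine (computable_pair _ _);
    comp
  | |- computable (fun x => @?F x :: @?G x) => refine (computable_cons _ _);
    comp
  | |- computable (fun x => (@?F x).+1) => refine (computable_op1 rec1_succ
    _); comp
  | |- computable (fun x => predn (@?F x)) =>
    refine (computable_op1 rec1_pred _); comp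
  | |- computable (fun x => double (@?F x)) =>
    refine (computable_op1 rec1_double _); comp
  | |- computable (fun x => maxn (@?F x) (@?G x)) =>
      refine (computable_op2 rec2_max _ _); comp
  | |- computable (fun x => addn (@?F x) (@?G x)) =>
      refine (computable_op2 rec2_add _ _); comp
  | |- computable (fun x => muln (@?F x) (@?G x)) =>
      refine (computable_op2 rec2_mul _ _); comp
  | |- computable (fun x => subn (@?F x) (@?G x)) =>
      refine (computable_op2 rec2_sub _ _); comp
  | |- computable (fun x => expn (@?F x) (@?G x)) =>
      refine (computable_op2 rec2_exp _ _); comp
  | |- computable (fun x => nat_of_bool (leq (@?F x) (@?G x))) =>
      refine (computable_op2 rec2_leq _ _); comp
  | |- computable (fun x => nat_of_bool (eq_op (@?F x) (@?G x))) =>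
      refine (computable_op2 rec2_eq _ _); comp
  | _ => first [eassumption | comp_hook | idtac]
  end.

Section ComputableSeq.
Context {T U V : Type} {eT : Enc T} {eU : Enc U} {eV : Enc V}.

Lemma enc_cons (u : U) l : enc (u :: l) = pairn (enc u) (enc l).
Proof. by []. Qed.

Lemma leq_size_enc (l : seq U) : (size l <= enc l)%N.
Proof.
elim: l => //= u l IHl; rewrite enc_cons.
apply: leq_trans (leq_pmull _ _); rewrite ?expn_gt0 // ltnS.
by rewrite (leq_trans IHl) // -addnn leq_addr.
Qed.

(** Primitive recursion on an accumulator paired with the rest of the list. The code of the list is
    at least its length and serves as the number of iterations; surplus iterations do nothing. *)
Lemma computable_foldl (S : T -> seq U) (A : T -> V) (G : T -> V -> U -> V) :
  computable S -> computable A ->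
  computable (fun p : T * V * U => G p.1.1 p.1.2 p.2) ->
  computable (fun x => foldl (G x) (A x) (S x)).
Proof.
move=> cS cA cG.
pose step x (p : V * seq U) := if p.2 is u :: l then (G x p.1 u, l) else p.
have cstep : computable (fun p : T * nat * (V * seq U) => step p.1.1 p.2).
  rewrite /step; refine (computable_seqcase _ _ _); [by comp|by comp|].
  refine (computable_pair _ _); last by comp.
  apply: (computable_comp (F := fun p : T * V * U => G p.1.1 p.1.2 p.2)
    (G := fun p : T * nat * (V * seq U) * (U * seq U) =>
       (p.1.1.1, p.1.2.1, p.2.1)) cG).
  by comp.
have cK : computable (fun x => enc (S x)) by case: cS => f rf fS; exists f.
have := computable_natrec (G := fun x (_ : nat) =>
  step x) cK (computable_pair cA cS) cstep.
move/computable_fst; apply: eq_computable => x.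
set K := enc (S x); have : (size (S x) <= K)%N := leq_size_enc _.
have -> : nat_rect (fun=> (V * seq U)%type) (A x, S x) (fun=> step x) K
    = iter K (step x) (A x, S x) by elim: K => //= K ->.
elim: K (A x) (S x) => [|K IHK] v [|u l] // leK; rewrite iterSr ?IHK //.
Qed.

End ComputableSeq.

Section ComputableSize.
Context {T U : Type} {eT : Enc T} {eU : Enc U}.

Lemma computable_size (S : T -> seq U) : computable S -> computable (fun x =>
  size (S x)).
Proof.
move=> cS; have cG : computable (fun p : T * nat * U => p.1.2.+1).
  by comp.
have := computable_foldl (G := fun=> fun n =>
  fun=> n.+1) cS (computable_const 0%N) cG.
apply: eq_computable => x; rewrite -[RHS]addn0.
by elim: (S x) 0%N => //= u l IHl n; rewrite IHl addnS.
Qed.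

Lemma computable_rev (S : T -> seq U) : computable S -> computable (fun x =>
  rev (S x)).
Proof.
move=> cS; have cG : computable (fun p : T * seq U * U => p.2 :: p.1.2).
  by comp.
have := computable_foldl (G := fun=> fun l u =>
  u :: l) cS (computable_const [::]) cG.
apply: eq_computable => x; rewrite -[rev _]cats0 -[_ ++ _]/(rev _ ++ [::]).
by rewrite -catrevE; elim: (S x) [::] => //= u l IHl l'; rewrite IHl.
Qed.

End ComputableSize.

Section ComputableFold.
Context {T U V : Type} {eT : Enc T} {eU : Enc U} {eV : Enc V}.

Lemma computable_foldr (S : T -> seq U) (A : T -> V) (G : T -> U -> V -> V) :
  computable S -> computable A ->
  computable (fun p : T * V * U => G p.1.1 p.2 p.1.2) ->
  computable (fun x => foldr (G x) (A x) (S x)).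
Proof.
move=> cS cA cG; have := computable_foldl (G := fun x v u =>
  G x u v) (computable_rev cS) cA cG.
by apply: eq_computable => x; rewrite foldl_rev.
Qed.

End ComputableFold.

Section ComputableIter.
Context {T U V : Type} {eT : Enc T} {eU : Enc U} {eV : Enc V}.

Lemma computable_map (S : T -> seq U) (G : T -> U -> V) : computable S ->
  computable (fun p : T * U => G p.1 p.2) ->
  computable (fun x => [seq G x u | u <- S x]).
Proof.
move=> cS cG.
have cG' : computable (fun p : T * seq V * U => G p.1.1 p.2 :: p.1.2).
  refine (computable_cons _ _); last by comp.
  apply: (computable_comp (F := fun p : T * U => G p.1 p.2)
    (G := fun p : T * seq V * U => (p.1.1, p.2)) cG).
  by comp.
exact: (computable_foldr (G := fun x u l => G x u :: l) cS (computable_const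
  [::]) cG').
Qed.

Lemma computable_sum (K : T -> nat) (F : T -> nat -> nat) : computable K ->
  computable (fun p : T * nat => F p.1 p.2) ->
  computable (fun x => \sum_(i < K x) F x i)%N.
Proof.
move=> cK cF.
have cG : computable (fun p : T * nat * nat => p.2 + F p.1.1 p.1.2)%N.
  refine (computable_op2 rec2_add _ _); first by comp.
  apply: (computable_comp (F := fun p : T * nat => F p.1 p.2)
    (G := fun p : T * nat * nat => p.1) cF).
  by comp.
have := computable_natrec (G := fun x i r => r + F x i)%N cK (computable_const
  0%N) cG.
apply: eq_computable => x; elim: (K x) => [|k IHk] /=; first
  by rewrite big_ord0.
by rewrite IHk big_ord_recr.
Qed.

Lemma computable_sum_seq (S : T -> seq U) (F : T -> U -> nat) : computable S ->
  computable (fun p : T * U => F p.1 p.2) ->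
  computable (fun x => \sum_(u <- S x) F x u)%N.
Proof.
move=> cS cF.
have cG : computable (fun p : T * nat * U => F p.1.1 p.2 + p.1.2)%N.
  refine (computable_op2 rec2_add _ _); last by comp.
  apply: (computable_comp (F := fun p : T * U => F p.1 p.2)
    (G := fun p : T * nat * U => (p.1.1, p.2)) cF).
  by comp.
have := computable_foldr (G := fun x u r => F x u + r)%N cS (computable_const
  0%N) cG.
apply: eq_computable => x; elim: (S x) => [|u l IHl] /=; first
  by rewrite big_nil.
by rewrite IHl big_cons.
Qed.

Lemma computable_max_seq (S : T -> seq U) (F : T -> U -> nat) : computable S ->
  computable (fun p : T * U => F p.1 p.2) ->
  computable (fun x => \max_(u <- S x) F x u)%N.
Proof.
move=> cS cF.
have cG : computable (fun p : T * nat * U => maxn (F p.1.1 p.2) p.1.2)%N.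
  refine (computable_op2 rec2_max _ _); last by comp.
  apply: (computable_comp (F := fun p : T * U => F p.1 p.2)
    (G := fun p : T * nat * U => (p.1.1, p.2)) cF).
  by comp.
have := computable_foldr (G := fun x u r => maxn (F x u) r)%N cS
  (computable_const 0%N) cG.
apply: eq_computable => x; elim: (S x) => [|u l IHl] /=; first
  by rewrite big_nil.
by rewrite IHl big_cons.
Qed.

Lemma computable_mkseq (K : T -> nat) (F : T -> nat -> V) : computable K ->
  computable (fun p : T * nat => F p.1 p.2) ->
  computable (fun x => mkseq (F x) (K x)).
Proof.
move=> cK cF.
have cG : computable (fun p : T * nat * seq V => F p.1.1 p.1.2 :: p.2).
  refine (computable_cons _ _); last by comp.
  apply: (computable_comp (F := fun p : T * nat => F p.1 p.2)
    (G := fun p : T * nat * seq V => p.1) cF).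
  by comp.
have := computable_rev
  (computable_natrec (G := fun x i l => F x i :: l) cK (computable_const [::])
    cG).
apply: eq_computable => x; rewrite -[RHS]revK; congr rev.
elim: (K x) => [|k IHk] //=.
by rewrite IHk /mkseq -[k.+1]addn1 iotaD map_cat rev_cat.
Qed.

Lemma computable_nth (S : T -> seq V) (K : T -> nat) (v0 : V) :
  computable S -> computable K -> computable (fun x => nth v0 (S x) (K x)).
Proof.
move=> cS cK.
have cG : computable (fun p : T * nat * seq V => behead p.2).
  apply: (eq_computable (F := fun p : T * nat * seq V =>
    if p.2 is _ :: l then l else [::])); first by case=> ? [].
  by refine (computable_seqcase _ _ _); comp.
have cd := computable_natrec (G := fun _ _ l => behead l) cK cS cG.
have ch : computable (fun x => if nat_rect (fun=> seq V) (S x)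
    (fun _ l => behead l) (K x) is v :: _ then v else v0).
  by refine (computable_seqcase _ _ _); comp.
apply: eq_computable ch => x.
suff -> : nat_rect (fun=> seq V) (S x) (fun _ l =>
  behead l) (K x) = drop (K x) (S x).
  by rewrite -[K x]addn0 -nth_drop addn0; case: drop.
elim: (K x) => [|k IHk] /=; first by rewrite drop0.
by rewrite IHk -drop1 drop_drop.
Qed.

Lemma computable_last (S : T -> seq V) (v0 : V) :
  computable S -> computable (fun x => last v0 (S x)).
Proof.
move=> cS; have cG : computable (fun p : T * V * V => p.2) by comp.
have := computable_foldl (G := fun=> fun=> id) cS (computable_const v0) cG.
by apply: eq_computable => x; elim: (S x) v0 => //= u l IHl v0.
Qed.

End ComputableIter.

(** * Recurrences satisfied by the walk numbers *)

(** Raising both the ceiling and the final sum from 0 to [h] makes the family stable under removal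
    of the first step. *)
Definition walks_below (S : {fset int}) (n h : nat) : {set n.-tuple S} :=
  [set w : n.-tuple S | (\sum_(i < n) val (tnth w i) == h%:Z)
     && [forall j : 'I_n, \sum_(i < n | (i <= j)%N) val (tnth w i) <= h%:Z]].

Lemma walks_below_cons (S : {fset int}) n h (x : S) (w : n.-tuple S) :
  ([tuple of x :: w] \in walks_below S n.+1 h)
    = (val x <= h%:Z) && (w \in walks_below S n `|h%:Z - val x|%N).
Proof.
rewrite !inE big_ord_recl tnth0.
under eq_bigr => i _ do rewrite tnthS.
have partial (j : 'I_n) : \sum_(i < n.+1 | (i <= lift ord0 j)%N)
    val (tnth [tuple of x :: w] i) = val x + \sum_(i < n | (i <= j)%N) val
      (tnth w i).
  rewrite big_mkcond big_ord_recl /= tnth0; congr (_ + _);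
    rewrite [RHS]big_mkcond.
  by apply: eq_bigr => i _; rewrite tnthS.
have [lexh|gtxh] := leP (val x) h%:Z; last first.
  apply/negbTE; rewrite negb_and; apply/orP; right; rewrite negb_forall.
  apply/existsP; exists ord0; rewrite big_mkcond big_ord_recl /= tnth0 big1
    ?addr0.
    by rewrite -ltNge.
  by [].
have -> : (`|h%:Z - val x|%N)%:Z = h%:Z - val x by rewrite gez0_abs // subr_ge0.
rewrite [in RHS]eq_sym subr_eq [in RHS]eq_sym [_ + val x]addrC /=;
  congr (_ && _).
apply/forallP/forallP => le_h j.
  by have := le_h (lift ord0 j); rewrite partial lerBrDl.
case: (unliftP ord0 j) => [j' ->|->]; first by rewrite partial -lerBrDl.
by rewrite big_mkcond big_ord_recl /= tnth0 big1 ?addr0.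
Qed.

Lemma card_walks_below (S : {fset int}) (s : seq int) n h :
  uniq s -> s =i S -> #|walks_below S n h| = walks_to_zero s n h.
Proof.
move=> uniq_s sS; elim: n h => [|n IHn] h /=.
  transitivity (\sum_(w : 0.-tuple S) (h == 0%N))%N; last first.
    by rewrite sum_nat_const card_tuple expn0 mul1n.
  rewrite -sum1_card big_mkcond; apply: eq_bigr => w _.
  rewrite inE big_ord0 eq_sym [_ && _]andbC.
  have -> : [forall j : 'I_0, \sum_(i < 0 | (i <= j)%N) val (tnth w i) <= h%:Z].
    by apply/forallP => -[].
  by rewrite eqz_nat; case: eqP.
have -> : (\sum_(x <- s | (x <= h%:Z)%R) walks_to_zero s n `|(h%:Z - x)%R|
    = \sum_(x : S | (val x <= h%:Z)%R) walks_to_zero s n `|(h%:Z - val x)%R|)%N.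
  rewrite -(big_seq_fsetE _ _ (fun x => x <= h%:Z)
    (fun x => walks_to_zero s n `|(h%:Z - x)%R|)) /=.
  by apply: perm_big; apply: uniq_perm; rewrite ?fset_uniq // => x; rewrite sS.
rewrite -sum1_card (reindex (fun p : S * n.-tuple S =>
  [tuple of p.1 :: p.2])) /=.
  rewrite (eq_bigl (fun p : S * n.-tuple S => (val p.1 <= h%:Z)
    && (p.2 \in walks_below S n `|h%:Z - val p.1|%N))) => [|p]; last first.
    exact: walks_below_cons.
  rewrite -(pair_big_dep (fun x : S => val x <= h%:Z)
    (fun x w => w \in walks_below S n `|h%:Z - val x|%N) (fun _ _ => 1%N)) /=.
  by apply: eq_bigr => x _; rewrite sum1_card IHn.
exists (fun w : n.+1.-tuple S => (thead w, [tuple of behead w])) =>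
  [[x w] _|w _] /=.
  by rewrite theadE; congr (_, _); apply: val_inj.
by rewrite -tuple_eta.
Qed.

Lemma walk_countE (S : {fset int}) (s : seq int) n :
  uniq s -> s =i S -> walk_count S n = walks_to_zero s n 0.
Proof. by move=> us sS; rewrite -(card_walks_below _ _ us sS). Qed.

Definition rec_value (a : nat -> nat) L (p : 'I_L.+1 -> {poly rat}) n : rat :=
  \sum_i (p i).[n%:R] * (a (n - i)%N)%:R.

(** Writing [n] as [(n - i) + i] expands [p i] in powers of [n - i], which [theta] produces. The two
    sums agree only for [n >= L], where every index [i <= L] occurs. *)
Lemma rec_value_ode a L R (p : 'I_L.+1 -> {poly rat}) :
  (forall i, (size (p i) <= R)%N) ->
  exists2 w : 'I_R -> {poly rat}, forall j, (size (w j) <= L.+1)%N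
    & forall n, (L <= n)%N -> ode_coef a w n = rec_value a p n.
Proof.
move=> szp; pose r (i : nat) := p (inord i) \Po ('X + i%:R%:P).
exists (fun j => \poly_(i < L.+1) (r i)`_j) => [j|n leLn];
  first exact: size_poly.
rewrite /ode_coef exchange_big /= /rec_value.
transitivity (\sum_(i < L.+1) (p (inord i)).[n%:R] * (a (n - i)%N)%:R);
  last first.
  by apply: eq_bigr => i _; rewrite inord_val.
rewrite (big_ord_widen n.+1 (fun i => (p (inord i)).[n%:R] * (a (n -
  i)%N)%:R)) //.
rewrite [RHS]big_mkcond; apply: eq_bigr => i _.
under eq_bigr => j _ do rewrite coef_poly.
case: ltnP => leiL; last by rewrite big1 // => j _; rewrite !mul0r.
have szr : (size (r i) <= R)%N.
  by rewrite size_comp_poly2 ?size_XaddC.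
rewrite -mulr_suml -(horner_coef_wide _ szr) horner_comp !hornerE -natrD.
by rewrite subnK // (leq_trans _ leLn).
Qed.

(** The opposite substitution: the coefficients of [t ^ i] form a polynomial in [n - i], composed
    with ['X - i]. *)
Lemma ode_rec_value a R (w : 'I_R -> {poly rat}) : (exists j, w j != 0) ->
  (forall n, ode_coef a w n = 0) ->
  exists (L : nat) (p : 'I_L.+1 -> {poly rat}),
    [/\ (0 < L)%N, exists i, p i != 0
      & forall n, (L <= n)%N -> rec_value a p n = 0].
Proof.
move=> [j0 nzw] ode; pose L := (\max_j size (w j)).+1.
have szw j : (size (w j) < L)%N by rewrite ltnS; apply: leq_bigmax.
pose r i : {poly rat} := \poly_(j < R) (if insub j is Some k then (w k)`_i
  else 0).
exists L, (fun i : 'I_L.+1 => r i \Po ('X - i%:R%:P)); split=> //.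
  (* The degree of a nonzero [w j0] is an index [i] at which the new polynomial is nonzero. *)
  have lti : ((size (w j0)).-1 < L.+1)%N.
    by rewrite ltnS (leq_trans (leq_pred _)) // ltnW.
  exists (Ordinal lti); rewrite -size_poly_gt0 size_comp_poly2 ?size_XsubC //.
  rewrite size_poly_gt0; apply: contraNneq nzw => /polyP/(_ j0).
  rewrite coef0 coef_poly ltn_ord valK -lead_coefE => /eqP.
  by rewrite lead_coef_eq0.
move=> n leLn; rewrite -[RHS](ode n) /rec_value /ode_coef exchange_big /=.
rewrite (big_ord_widen n.+1
  (fun i => (r i \Po ('X - i%:R%:P)).[n%:R] * (a (n - i)%N)%:R)) //.
rewrite big_mkcond; apply: eq_bigr => i _.
case: ltnP => leiL; last first.
  by rewrite big1 // => j _; rewrite nth_default ?mul0r // (leq_trans (ltnW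
    (szw j))) // ltnW.
rewrite -mulr_suml horner_comp !hornerE -natrB ?(leq_trans _ leLn) //.
congr (_ * _); rewrite (@horner_coef_wide _ R) ?size_poly //.
by apply: eq_bigr => j _; rewrite coef_poly ltn_ord valK.
Qed.

(** The summand [L + 1] serves step sets without negative steps: past it every [n - i] is positive,
    where the walk numbers vanish. *)
Definition check_bound s R L :=
  (check_gauge (max_down s) (root_bound s) (step_gauge s) R L + L + 1)%N.

Section WalkRecurrence.
Variable s : seq int.
Hypotheses (uniq_s : uniq s) (s_neq0 : 0 \notin s).
Local Notation a := (fun n => walks_to_zero s n 0).

Lemma walks_to_zero_nonneg n : max_down s = 0%N -> a n.+1 = 0%N.
Proof.
move=> d0; rewrite /= big_seq_cond big1 // => x /andP[xs lex0].
have := max_down_ge xs; rewrite d0 oppr0 => le0x.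
by case/negP: s_neq0; have /eqP <- : x == 0 by rewrite eq_le lex0 le0x.
Qed.

Lemma walk_recurrence_exists : exists (L : nat) (p : 'I_L.+1 -> {poly rat}),
  [/\ (0 < L)%N, exists i, p i != 0
    & forall n, (L <= n)%N -> rec_value a p n = 0].
Proof.
have [d0|d_gt0] := posnP (max_down s); last first.
  by have [R [w [nzw /(ode_rec_value nzw)]]] :=
    walk_ode_exists uniq_s s_neq0 d_gt0.
exists 1%N, (fun i => if i == ord0 then 'X else 0); split=> // [|[//|n] _].
  by exists ord0; rewrite eqxx polyX_eq0.
rewrite /rec_value big_ord_recl big_ord1 eqxx subn0 walks_to_zero_nonneg //.
by rewrite mulr0 horner0 mul0r addr0.
Qed.

Lemma walk_recurrence_check L R (p : 'I_L.+1 -> {poly rat}) :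
  (forall i, (size (p i) <= R)%N) ->
  (forall n, (L <= n < check_bound s R L)%N -> rec_value a p n = 0) ->
  forall n, (L <= n)%N -> rec_value a p n = 0.
Proof.
move=> szp check n leLn; have [d0|d_gt0] := posnP (max_down s).
  have [lt_n|] := ltnP n (check_bound s R L); first by rewrite check ?leLn.
  rewrite /check_bound => le_n; rewrite /rec_value big1 // => i _.
  have -> : (n - i = (n - i).-1.+1)%N by have := ltn_ord i; lia.
  by rewrite walks_to_zero_nonneg // mulr0.
have [w szw wE] := rec_value_ode a szp.
rewrite -wE //; apply: (walk_ode_check uniq_s s_neq0 d_gt0 szw) =>
  // k /andP[leLk ltk].
by rewrite wE // check // leLk /check_bound -addnA ltn_addr.
Qed.

End WalkRecurrence.

Lemma clear_denominators (I : finType) (p : I -> {poly rat}) :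
  exists2 k : rat, k != 0 &
    exists q : I -> {poly int}, forall i, k *: p i = map_poly intr (q i).
Proof.
have [|q qP] := choice (_ : forall i, exists q : {poly int} * int,
    q.2 != 0 /\ p i = q.2%:~R^-1 *: map_poly intr q.1).
  by move=> i; have [q [b nzb ->]] := rat_poly_scale (p i); exists (q, b).
exists (\prod_i (q i).2%:~R).
  by apply/prodf_neq0 => i _; rewrite intr_eq0; case: (qP i).
exists (fun i => (\prod_(j | j != i) (q j).2) *: (q i).1) => i.
have [nzb pE] := qP i; rewrite {1}pE scalerA (bigD1 i) //= mulrAC divff
  ?intr_eq0 //.
by rewrite mul1r linearZ /= rmorph_prod.
Qed.

(** * The search algorithm *)

(** Positive and negative parts let the program work in [nat]: vanishing of an integer value becomes
    equality of two naturals. *)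
Definition step_up (x : int) : nat := if x is Posz k then k else 0%N.

Lemma step_up_down x : x = (step_up x)%:Z - (step_down x)%:Z.
Proof. by case: x => k /=; rewrite ?subr0 // NegzE sub0r. Qed.

Definition step_term (tab : seq nat) (h : nat) (x : int) : nat :=
  match x with
  | Posz k => if (k <= h)%N then nth 0%N tab (h - k) else 0%N
  | Negz k => nth 0%N tab (h + k.+1)
  end.

Definition next_table (s : seq int) (tab : seq nat) (n : nat) : seq nat :=
  mkseq (fun h => \sum_(x <- s) step_term tab h x)%N (n.+1 * max_step s).+1.

(** Tabulating all heights turns the branching recursion of [walks_to_zero] into primitive recursion
    on [n]; beyond the table the default 0 is the true value. *)
Definition walk_table (s : seq int) (n : nat) : seq nat :=
  nat_rect (fun=> seq nat) [:: 1%N] (fun k tab => next_table s tab k) n.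

Lemma nth_walk_table s n h : nth 0%N (walk_table s n) h = walks_to_zero s n h.
Proof.
elim: n h => [|n IHn] h; first by case: h => [|[]].
have [lth|leh] := ltnP h (n.+1 * max_step s).+1; last first.
  by rewrite walks_to_zero_big // nth_default // size_mkseq.
rewrite [walk_table _ _]/= nth_mkseq //= [RHS]big_mkcond; apply: eq_bigr => x _.
case: x => k /=; rewrite !IHn.
  by rewrite lez_nat; case: leqP => // lekh; congr walks_to_zero; lia.
by congr walks_to_zero; lia.
Qed.

Definition eval_part (part : int -> nat) (n : nat) (c : seq int) : nat :=
  foldr (fun x r => part x + n * r)%N 0%N c.

Definition int_poly (c : seq int) : {poly rat} := Poly (map intr c).

Lemma horner_int_poly c n : (int_poly c).[n%:R]
  = (eval_part step_up n c)%:R - (eval_part step_down n c)%:R.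
Proof.
elim: c => [|x c IHc] /=; first by rewrite horner0 subrr.
rewrite horner_cons IHc {1}[x]step_up_down rmorphB /= !natrD !natrM; ring.
Qed.

Definition rec_part (part : int -> nat) (s : seq int) (l : seq (seq int)) (n :
  nat) :=
  (\sum_(i < size l) eval_part part n (nth [::] l i)
     * nth 0 (walk_table s (n - i)) 0)%N.

(** The default 1 lets the empty list, which stands for the zero polynomial, pass the test for
    leading zeros. *)
Definition lead_int (c : seq int) : int := last 1 c.

(** A computable bound for the size of every polynomial of the candidate, which vanishes only when
    all its lists are empty. *)
Definition total_size (l : seq (seq int)) : nat := (\sum_(c <- l) size c)%N.

(* A candidate [l] lists the integer coefficients of its polynomials, constant
   terms first; every natural number encodes one. The four terms test the order,
   the absence of leading zeros, nontriviality, and the finite check. *)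
Definition defect (s : seq int) (l : seq (seq int)) : nat :=
  ((size l <= 1) + \sum_(c <- l) (step_up (lead_int c) + step_down (lead_int
    c) == 0)
   + (total_size l == 0)
   + \sum_(n < check_bound s (total_size l) (size l).-1)
       ((size l).-1 <= n)
       * (1 - (rec_part step_up s l n == rec_part step_down s l n)))%N.

Lemma rec_value_parts s L (l : seq (seq int)) n : size l = L.+1 ->
  rec_value (fun n => walks_to_zero s n 0) (fun i : 'I_L.+1 =>
    int_poly (nth [::] l i)) n
    = (rec_part step_up s l n)%:R - (rec_part step_down s l n)%:R.
Proof.
move=> szl; rewrite /rec_part szl !natr_sum -sumrB; apply: eq_bigr => i _.
by rewrite horner_int_poly nth_walk_table mulrBl !natrM.
Qed.

Lemma rec_value_part_eq s L (l : seq (seq int)) n : size l = L.+1 ->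
  (rec_value (fun n => walks_to_zero s n 0)
     (fun i : 'I_L.+1 => int_poly (nth [::] l i)) n == 0)
    = (rec_part step_up s l n == rec_part step_down s l n).
Proof. by move=> szl; rewrite rec_value_parts // subr_eq0 eqr_nat. Qed.

Lemma leq_total_size (l : seq (seq int)) i : (size (nth [::] l i) <=
  total_size l)%N.
Proof.
have [lt|ge] := ltnP i (size l); last by rewrite nth_default.
by rewrite /total_size (big_nth [::]) big_mkord (bigD1 (Ordinal lt)) //=
  leq_addr.
Qed.

Section Defect.
Variables (s : seq int).
Hypotheses (uniq_s : uniq s) (s_neq0 : 0 \notin s).
Local Notation a := (fun n => walks_to_zero s n 0).

Lemma defect_eq0P l : defect s l = 0%N ->
  [/\ (1 < size l)%N, forall c, c \in l -> lead_int c != 0, exists2 c, c \in l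
    & c != [::]
    & forall L, size l = L.+1 -> forall n, (L <= n)%N ->
        rec_value a (fun i : 'I_L.+1 => int_poly (nth [::] l i)) n = 0].
Proof.
move/eqP; rewrite !addn_eq0 !eqb0 -ltnNge !sum_nat_seq_eq0.
case/andP=> /andP[/andP[szl /allP lastl] nzl] /allP check; split=> //.
- move=> c /lastl /=; rewrite eqb0; apply: contra => /eqP c0.
  by rewrite c0.
- case: (boolP (has (fun c => c != [::]) l)) => [/hasP[c]|/hasPn nil_l];
  first by exists c.
  case/negP: nzl; apply/allP => c /nil_l.
  by rewrite negbK => /eqP ->.
move=> L szL; apply: (walk_recurrence_check uniq_s s_neq0 (R :=
  total_size l)) => [i|n].
  by apply: leq_trans (size_Poly _) _; rewrite size_map leq_total_size.
move=> /andP[leLn ltn]; apply/eqP; rewrite rec_value_part_eq //.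
move: ltn; rewrite -[L]/(L.+1.-1) -szL => ltn; have :=
  check (Ordinal ltn) (mem_index_enum _).
by rewrite /= szL leLn mul1n subn_eq0; case: eqP.
Qed.

(** Scaling an existing recurrence by one common denominator keeps it a recurrence, and the
    coefficient lists of the integer polynomials have no leading zeros. *)
Lemma defect_eq0_exists : exists l, defect s l = 0%N.
Proof.
have [L [p [L_gt0 [i0 nzp] pE]]] := walk_recurrence_exists uniq_s s_neq0.
have [k nzk [q qE]] := clear_denominators p.
pose l := [seq (q i : seq int) | i <- enum 'I_L.+1].
have szl : size l = L.+1 by rewrite size_map size_enum_ord.
have nthl (i : 'I_L.+1) : nth [::] l i = q i.
  by rewrite (nth_map i) ?size_enum_ord // nth_ord_enum.
have int_q (i : 'I_L.+1) : int_poly (nth [::] l i) = k *: p i.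
  by rewrite nthl qE map_polyE.
exists l; apply/eqP; rewrite !addn_eq0 !eqb0 -ltnNge !sum_nat_seq_eq0 szl ltnS
  L_gt0 /=.
apply/andP; split; [apply/andP; split|].
- apply/allP => _ /mapP[i _ ->] /=; rewrite eqb0; apply/negP => /eqP l0.
  have : lead_int (q i) = 0.
    by rewrite [LHS]step_up_down; case: (step_up _) (step_down _) l0 => [|?] [].
  by apply/eqP; case: (q i).
- apply: contra nzp => /allP/(_ (nth [::] l i0)); rewrite mem_nth ?szl //= nthl.
  rewrite size_poly_eq0 => /(_ isT)/eqP q0; have /eqP := qE i0.
  by rewrite q0 rmorph0 scaler_eq0 (negPf nzk).
- apply/allP => n _ /=; case: leqP => // leLn; rewrite mul1n subn_eq0.
  rewrite -(rec_value_part_eq _ _ szl); set v := rec_value _ _ _.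
  have -> : v = k * rec_value a p n.
    by rewrite /v mulr_sumr; apply: eq_bigr => i _; rewrite int_q hornerZ mulrA.
  by rewrite pE // mulr0 eqxx.
Qed.

End Defect.

(** * Computability of the test *)

Lemma computable_step_up {T} {eT : Enc T} (I : T -> int) :
  computable I -> computable (fun x => step_up (I x)).
Proof. by move=> cI; refine (computable_intcase cI _ _); comp. Qed.

Lemma computable_step_down {T} {eT : Enc T} (I : T -> int) :
  computable I -> computable (fun x => step_down (I x)).
Proof. by move=> cI; refine (computable_intcase cI _ _); comp. Qed.

Ltac comp_hook ::= lazymatch goal with
  | |- computable (fun x => step_up (@?F x)) => refine (computable_step_up _);
    comp
  | |- computable (fun x => step_down (@?F x)) =>
    refine (computable_step_down _); comp
  | |- computable (fun x => size (@?F x)) => refine (computable_size _); comp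
  | |- computable (fun x => nth ?d (@?F x) (@?G x)) =>
    refine (computable_nth d _ _); comp
  end.

Lemma computable_step_term :
  computable (fun p : seq nat * nat * int => step_term p.1.1 p.1.2 p.2).
Proof.
refine (computable_intcase _ _ _); [by comp| |by comp].
by refine (computable_if _ _ _); comp.
Qed.

Lemma absz_step (x : int) : `|x|%N = (step_up x + step_down x)%N.
Proof. by case: x => k; rewrite ?addn0. Qed.

Lemma computable_max_step {T} {eT : Enc T} (S : T -> seq int) :
  computable S -> computable (fun x => max_step (S x)).
Proof.
move=> cS.
have cF : computable (fun p : T * int => step_up p.2 + step_down p.2)%N by comp.
apply: eq_computable (computable_max_seq (F := fun=> fun x =>
  step_up x + step_down x)%N cS cF) => x.
by apply: eq_bigr => i _; rewrite absz_step.
Qed.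

Lemma computable_max_down {T} {eT : Enc T} (S : T -> seq int) :
  computable S -> computable (fun x => max_down (S x)).
Proof.
move=> cS; have cF : computable (fun p : T * int => step_down p.2) by comp.
exact: (computable_max_seq (F := fun=> step_down) cS cF).
Qed.

Lemma computable_check_bound {T} {eT : Enc T} (S : T -> seq int) (R L : T ->
  nat) :
  computable S -> computable R -> computable L ->
  computable (fun x => check_bound (S x) (R x) (L x)).
Proof.
move=> cS cR cL; have cd := computable_max_down cS; have cm :=
  computable_max_step cS.
rewrite /check_bound /check_gauge /ode_gauge /theta_gauge /root_gauge
  /delta_gauge.
by rewrite /inv_gauge /kappa_gauge /mul_gauge /step_gauge /root_bound; comp.
Qed.

Lemma computable_next_table :
  computable (fun p : seq int * nat * seq nat => next_table p.1.1 p.2 p.1.2).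
Proof.
refine (computable_mkseq _ _).
  have c1 : computable (fun p : seq int * nat * seq nat => max_step p.1.1).
    by apply: computable_max_step; comp.
  by comp.
refine (computable_sum_seq _ _); first by comp.
refine (computable_comp (F := fun p : seq nat * nat * int =>
  step_term p.1.1 p.1.2 p.2)
  (G := fun p : seq int * nat * seq nat * nat * int => (p.1.1.2, p.1.2, p.2))
  computable_step_term _).
by comp.
Qed.

Lemma computable_walk_table {T} {eT : Enc T} (S : T -> seq int) (N : T -> nat) :
  computable S -> computable N -> computable (fun x => walk_table (S x) (N x)).
Proof.
move=> cS cN.
refine (computable_natrec (G := fun x k tab => next_table (S x) tab k) cN
  (computable_const _) _).
have cS' : computable (fun p : T * nat * seq nat => S p.1.1).
  by refine (computable_comp cS _); comp.
refine (computable_comp (G := fun p : T * nat * seq nat =>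
  (S p.1.1, p.1.2, p.2))
  computable_next_table _).
by comp.
Qed.

Lemma computable_eval_part (part : int -> nat) {T} {eT : Enc T} (N : T ->
  nat) (C : T -> seq int) :
  computable part -> computable N -> computable C ->
  computable (fun x => eval_part part (N x) (C x)).
Proof.
move=> cp cN cC; refine (computable_foldr (G := fun x u r =>
  part u + N x * r)%N cC
  (computable_const _) _).
have c1 : computable (fun p : T * nat * int => part p.2).
  by refine (computable_comp cp _); comp.
have c2 : computable (fun p : T * nat * int => N p.1.1).
  by refine (computable_comp cN _); comp.
by comp.
Qed.

Local Notation cand := (seq int * seq (seq int))%type.

Lemma computable_rec_part (part : int -> nat) : computable part ->
  computable (fun p : cand * nat => rec_part part p.1.1 p.1.2 p.2).
Proof.
move=> cp; refine (computable_sum (F := fun (p : cand * nat) i =>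
  eval_part part p.2 (nth [::] p.1.2 i) * nth 0 (walk_table p.1.1 (p.2 - i))
    0)%N _ _).
  by comp.
refine (computable_op2 rec2_mul _ _).
  by refine (computable_eval_part cp _ _); comp.
refine (computable_nth _ _ _); last by comp.
by refine (computable_walk_table _ _); comp.
Qed.

Lemma computable_defect : computable (fun p : cand => defect p.1 p.2).
Proof.
have cts : computable (fun p : cand => total_size p.2).
  by refine (computable_sum_seq _ _); comp.
have cup : computable step_up by refine (computable_step_up computable_id).
have cdn : computable step_down by refine (computable_step_down computable_id).
have clast : computable (fun p : cand =>
    \sum_(c <- p.2) (step_up (lead_int c) + step_down (lead_int c) == 0))%N.
  refine (computable_sum_seq _ _); first by comp.
  have cl : computable (fun p : cand * seq int => lead_int p.2).
    by refine (computable_last _ _); comp.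
  by comp.
have cck : computable (fun p : cand => \sum_(n < check_bound p.1 (total_size
  p.2)
      (size p.2).-1) ((size p.2).-1 <= n)
      * (1 - (rec_part step_up p.1 p.2 n == rec_part step_down p.1 p.2 n)))%N.
  refine (computable_sum (F := fun (p : cand) n => ((size p.2).-1 <= n)
      * (1 - (rec_part step_up p.1 p.2 n == rec_part step_down p.1 p.2 n)))%N
        _ _).
    by refine (computable_check_bound _ _ _); comp.
  have c1 := computable_rec_part cup; have c2 := computable_rec_part cdn.
  by comp.
by rewrite /defect; comp.
Qed.

(** Puts each integer over denominator 1, so that [enc] of the result is the code of the rational
    polynomials. *)
Definition rat_polys (l : seq (seq int)) : seq (seq (seq int)) :=
  [seq [seq [:: z; 1] | z <- c] | c <- l].

Lemma computable_rat_polys : computable rat_polys.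
Proof.
refine (computable_map computable_id _).
by refine (computable_map _ _); comp.
Qed.

Lemma code_int_surj k : exists z, code_int z = k.
Proof.
exists (if odd k then Negz k./2 else Posz k./2).
by rewrite -{4}(odd_double_half k); case: (odd k).
Qed.

(** Every natural number encodes a candidate, so the search may run over all of [nat]. *)
Lemma enc_seq_surj {T} {eT : Enc T} :
  (forall k, exists x : T, enc x = k) -> forall k, exists l : seq T, enc l = k.
Proof.
move=> /choice [dec decK] k; exists (map dec (CodeSeq.decode k)).
rewrite /enc /enc_seq -map_comp map_id_in ?CodeSeq.decodeK // => x _.
exact: decK.
Qed.

(** A polynomial is encoded by its normalised coefficients; without leading zeros these are the
    candidate's own lists. *)
Lemma code_polys_rat_polys (l : seq (seq int)) :
  (forall c, c \in l -> lead_int c != 0) ->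
  code_polys (map int_poly l) = enc (rat_polys l).
Proof.
move=> leadl; rewrite /code_polys /rat_polys /enc /enc_seq -!map_comp.
congr CodeSeq.code; apply/eq_in_map => c /leadl nzc /=.
rewrite /code_poly /int_poly (@PolyK _ 1).
  rewrite {1}/enc /enc_seq -!map_comp; congr CodeSeq.code; apply: eq_map =>
    z /=.
  by rewrite /code_rat numq_int denq_int.
by rewrite -[1]/(1%:~R) last_map intr_eq0.
Qed.

Local Open Scope fset_scope.

Theorem theorem5 :
  (forall S : {fset int}, 0 \notin S -> P_recursive (walk_count S)) /\
  (exists f : recfun 1,
     forall (S : {fset int}) (s : seq int),
       0 \notin S -> uniq s -> s =i S ->
       exists (L : nat) (p : L.+1.-tuple {poly rat}),
         is_P_recurrence (walk_count S) p /\
         computes f [tuple code_ints s] (code_polys p)).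
Proof.
(* The output of the algorithm is itself a recurrence, so the second half implies the first. *)
suff [f fP] : exists f : recfun 1,
     forall (S : {fset int}) (s : seq int),
       0 \notin S -> uniq s -> s =i S ->
       exists (L : nat) (p : L.+1.-tuple {poly rat}),
         is_P_recurrence (walk_count S) p /\
         computes f [tuple code_ints s] (code_polys p).
  split; last by exists f.
  move=> S S0; have [L [p [pP _]]] := fP S (enum_fset S) S0 (fset_uniq S)
    (fun=> erefl).
  by exists L, p.
have [D [D1 D1P] DE] := computable_defect.
have [O [out outP] OE] := computable_rat_polys.
have [g gP] : rec2 (fun z x => D (pairn x z)).
  by apply: (rec2_comp1 _ (rec2_comp2 rec2_pair rec2_2 rec2_1)); exists D1.
(* Minimisation finds the least code of defect 0, and [out] recodes that candidate. *)
exists (RComp out (fun _ : 'I_1 => RMu g)) => S s S0 uniq_s sS.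
have s0 : 0 \notin s by rewrite sS.
have surj := enc_seq_surj (enc_seq_surj code_int_surj).
have encE (l : seq (seq int)) : pairn (code_ints s) (enc l) = enc (s, l) by [].
have exz : exists z, D (pairn (code_ints s) z) == 0%N.
  have [l l0] := defect_eq0_exists uniq_s s0.
  by exists (enc l); rewrite encE DE /= l0.
case: (ex_minnP exz) => z /eqP z0 min_z; have [l lz] := surj z.
have l0 : defect s l = 0%N.
  by have := DE (s, l); rewrite -encE lz z0.
have [szl leadl [c cl nzc] recl] := defect_eq0P uniq_s s0 l0.
have szlL : size l = (size l).-1.+1 by rewrite prednK // ltnW.
have szp : size (map int_poly l) == (size l).-1.+1 by rewrite size_map -szlL.
exists (size l).-1, (Tuple szp); split.
  split=> [||n leLn].
  - by rewrite -subn1 subn_gt0.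
  - have ltc : (index c l < (size l).-1.+1)%N by rewrite -szlL index_mem.
    exists (Ordinal ltc); rewrite (tnth_nth 0) /= (nth_map [::]) ?index_mem //.
    rewrite nth_index // -size_poly_eq0 /int_poly (@PolyK _ 1) ?size_map
      ?size_eq0 //.
    by rewrite -[1]/(1%:~R) last_map intr_eq0; apply: leadl.
  - rewrite -[RHS](recl _ szlL n leLn); apply: eq_bigr => i _.
    have lti : (i < size l)%N by have := ltn_ord i; rewrite -{2}szlL.
    rewrite (tnth_nth 0) /= (nth_map [::]) //.
    by rewrite (walk_countE _ uniq_s sS).
have -> : code_polys (Tuple szp) = enc (rat_polys l) :=
  code_polys_rat_polys leadl.
exists [tuple z]; split=> [i|].
  rewrite (tnth_nth 0%N) ord1 /=; split.
    have := gP [tuple z; code_ints s]; rewrite !(tnth_nth 0%N) /= inordK //= z0.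
    by congr computes; apply: val_inj.
  (* Minimality of [z] makes the earlier values positive, and [RMu] asks for their predecessors. *)
  move=> k ltkz; exists (D (pairn (code_ints s) k)).-1.
  have := gP [tuple k; code_ints s]; rewrite !(tnth_nth 0%N) /= inordK //=.
  rewrite prednK; first by congr computes; apply: val_inj.
  by rewrite lt0n; apply: contraTN ltkz => /min_z; rewrite -leqNgt.
by have := outP [tuple z]; rewrite (tnth_nth 0%N) /= -lz OE.
Qed.
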